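(* Let $\Omega\subset\mathbb{R}^2$ be (the domain defined by) an equilateral triangle with vertices $z_1,z_2,z_3$. Let $f\in L^2(\Omega)$, or let $f$ be a continuous functional on $H^1_0(\Omega)$, and let $u\in H^1_0(\Omega)$ be the (weak) solution of $-\Delta u=f$ in $\Omega$, $u=0$ on $\partial\Omega$. Then $$\int_\Omega u=\sqrt3\,|\Omega|\int_\Omega f\,B,$$ where $B=\lambda_1\lambda_2\lambda_3$ and $|\Omega|$ denotes the area of $\Omega$.
   Context: $\lambda_1,\lambda_2,\lambda_3$ are the linear (affine) functions on the triangle with $\lambda_i(z_j)=\delta_{ij}$, $i,j=1,2,3$; the bubble function $B$ belongs to $H^1_0(\Omega)$. The weak solution $u\in H^1_0(\Omega)$ is the unique function satisfying $\int_\Omega\nabla u\cdot\nabla v=(f,v)$ for all $v\in H^1_0(\Omega)$, where $(f,v)=\int_\Omega f v$ when $f\in L^2(\Omega)$; when $f$ is a continuous functional on $H_0^1(\Omega)$, $(f,v)$ and $\int_\Omega f v$ denote the action of $f$ on $v$. *)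

(* Defs.v *)
From HB Require Import structures.
From mathcomp Require Import all_boot all_order all_algebra.
From mathcomp Require Import all_classical all_reals all_analysis.

Set Implicit Arguments.
Unset Strict Implicit.
Unset Printing Implicit Defensive.

Import Order.TTheory GRing.Theory Num.Theory.
Import numFieldNormedType.Exports.

Local Open Scope classical_set_scope.
Local Open Scope ring_scope.

(* The plane is R * R.  Its normed-space structure carries the sup norm (which
   gives the usual topology); the Euclidean distance is defined separately. *)
Definition edist {R : realType} (p q : R * R) : R :=
  Num.sqrt ((p.1 - q.1) ^+ 2 + (p.2 - q.2) ^+ 2).

Definition area {R : realType} :=
  ((@lebesgue_measure R) \x (@lebesgue_measure R))%E.

Definition integral_on {R : realType} (O : set (R * R)) (f : R * R -> R) : R :=
  Rintegral area O f.

Definition unit_vector {R : realType} (i : 'I_2) : R * R :=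
  if i == 0 then (1, 0) else (0, 1).

Definition partial {R : realType} (i : 'I_2) (f : R * R -> R) : R * R -> R :=
  fun p => 'D_(unit_vector i) f p.

Definition iter_partial {R : realType} (s : seq 'I_2) (f : R * R -> R) :
    R * R -> R := foldr partial f s.

Definition smooth {R : realType} (f : R * R -> R) : Prop :=
  forall s : seq 'I_2,
    (forall p (i : 'I_2), derivable (iter_partial s f) p (unit_vector i)) /\
    continuous (iter_partial s f).

Definition support {R : realType} (f : R * R -> R) : set (R * R) :=
  closure [set p | f p != 0].

(* C_c^oo(O), its elements being extended by zero to the plane *)
Definition test_function {R : realType} (O : set (R * R)) (phi : R * R -> R) :
    Prop :=
  [/\ smooth phi, compact (support phi) & support phi `<=` O].

(* f \_ O is f on O and 0 elsewhere, so that values outside of O are ignored *)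
Definition L2 {R : realType} (O : set (R * R)) (f : R * R -> R) : Prop :=
  (f \_ O) \in Lfun (@area R) 2%:E.

Definition weak_gradient {R : realType} (O : set (R * R)) (u : R * R -> R)
    (Du : 'I_2 -> R * R -> R) : Prop :=
  forall (phi : R * R -> R), test_function O phi -> forall i : 'I_2,
    integral_on O (fun p => u p * partial i phi p) =
    - integral_on O (fun p => Du i p * phi p).

(* Sobolev functions are represented together with a weak gradient, which is
   determined by u up to almost everywhere equality on O. *)
Definition H1 {R : realType} (O : set (R * R)) (u : R * R -> R)
    (Du : 'I_2 -> R * R -> R) : Prop :=
  [/\ L2 O u, forall i, L2 O (Du i) & weak_gradient O u Du].

Definition H1norm {R : realType} (O : set (R * R)) (u : R * R -> R)
    (Du : 'I_2 -> R * R -> R) : R :=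
  Num.sqrt (integral_on O (fun p => u p ^+ 2) +
            \sum_(i < 2) integral_on O (fun p => Du i p ^+ 2)).

Definition H1dist {R : realType} (O : set (R * R))
    (u : R * R -> R) (Du : 'I_2 -> R * R -> R)
    (v : R * R -> R) (Dv : 'I_2 -> R * R -> R) : R :=
  H1norm O (fun p => u p - v p) (fun i p => Du i p - Dv i p).

(* closure of C_c^oo(O) in H^1(O) *)
Definition H10 {R : realType} (O : set (R * R)) (u : R * R -> R)
    (Du : 'I_2 -> R * R -> R) : Prop :=
  H1 O u Du /\
  forall e : R, 0 < e -> exists2 phi : R * R -> R, test_function O phi &
    H1dist O u Du phi (fun i => partial i phi) < e.

(* Only the values of F on H^1_0(O) matter.  Continuity also forces F to take
   the same value on functions which are equal almost everywhere on O. *)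
Definition continuous_functional_H10 {R : realType} (O : set (R * R))
    (F : (R * R -> R) -> R) : Prop :=
  (forall (a : R) u Du v Dv, H10 O u Du -> H10 O v Dv ->
     F (fun p => a * u p + v p) = a * F u + F v) /\
  (forall u Du, H10 O u Du -> forall e : R, 0 < e ->
     exists2 d : R, 0 < d & forall v Dv, H10 O v Dv ->
       H1dist O v Dv u Du < d -> `|F v - F u| < e).

(* u is in H^1_0(O) and solves - Laplacian u = F weakly, F being given by its
   action on H^1_0(O) *)
Definition weak_solution {R : realType} (O : set (R * R))
    (F : (R * R -> R) -> R) (u : R * R -> R) : Prop :=
  exists2 Du : 'I_2 -> R * R -> R, H10 O u Du &
    forall v Dv, H10 O v Dv ->
      integral_on O (fun p => \sum_(i < 2) Du i p * Dv i p) = F v.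

Definition closed_triangle {R : realType} (z : 'I_3 -> R * R) : set (R * R) :=
  [set p | exists a : 'I_3 -> R,
    [/\ forall i, 0 <= a i, \sum_(i < 3) a i = 1 &
        p = \sum_(i < 3) a i *: z i]].

Definition triangle_domain {R : realType} (z : 'I_3 -> R * R) : set (R * R) :=
  interior (closed_triangle z).

Definition equilateral {R : realType} (z : 'I_3 -> R * R) : Prop :=
  exists2 s : R, 0 < s & forall i j, i != j -> edist (z i) (z j) = s.

Definition affine_function {R : realType} (l : R * R -> R) : Prop :=
  exists a b c : R, forall p, l p = a * p.1 + b * p.2 + c.

Definition barycentric {R : realType} (z : 'I_3 -> R * R)
    (lambda : 'I_3 -> R * R -> R) : Prop :=
  forall i, affine_function (lambda i) /\
            forall j, lambda i (z j) = (i == j)%:R.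

Definition bubble {R : realType} (lambda : 'I_3 -> R * R -> R) : R * R -> R :=
  fun p => \prod_(i < 3) lambda i p.

(* Main.v *)
(* Each lambda_i has a gradient of constant norm, and any two gradients make the same
   angle, so grad lambda_i . grad lambda_j = - k / 2 for i <> j, where k = 4 / (3 s^2)
   and s is the side. Hence Laplacian B = 2 * (- k / 2) * (lambda_1 + lambda_2 + lambda_3)
   = - k, while |Omega| = 1 / (sqrt 3 k). Testing the weak equation with B and
   integrating by parts against u gives F(B) = int grad u . grad B = k int u. Two points
   need work: B is a limit in H^1 of the test functions prod_j g_a(lambda_j), where the
   smooth g_a vanishes on ]-oo, a]; and the integration by parts extends from test
   functions to H^1_0 by density. *)

Require Import Defs.
From HB Require Import structures.
From mathcomp Require Import all_boot all_order all_algebra.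
From mathcomp Require Import all_classical all_reals all_analysis.
From mathcomp Require Import measurable_realfun ring lra.

Set SsrOldRewriteGoalsOrder.

Import Order.TTheory GRing.Theory Num.Theory.
Import numFieldNormedType.Exports.

Local Open Scope classical_set_scope.
Local Open Scope ring_scope.

(** [smooth] quantifies over iterated partial derivatives of every order, so the test functions are
    drawn from an explicit class stable under differentiation. Besides constants and coordinates,
    one family of functions of one variable is enough: [P(1/s) e^(-a/s)] for [s > 0], extended by 0,
    with [P] an arbitrary polynomial. Its derivative has the same form with another [P], also at the
    junction [s = 0]. The bubble function, its derivatives and the approximating test functions all
    belong to this class.

    The integration by parts has to pair [u] with [partial i B], which does not vanish on the
    boundary. The boundary term disappears thanks to [u], so it is [u] that is approximated by test
    functions, while the other factor is any function smooth on the whole plane.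

    The side of the triangle is hidden in [k]: the area and the Laplacian are both derived from the
    pairwise products of the gradients, their squared norms being recovered from the fact that the
    three gradients add up to 0. The constant [k] cancels in the final identity. *)

Local Notation plane R := (measurableTypeR R * measurableTypeR R)%type (only parsing).

(** * Smooth functions *)

Definition bump {R : realType} (a : R) (P : {poly R}) (s : R) : R :=
  if 0 < s then P.[s^-1] * expR (- (a / s)) else 0.

(** The exponential beats every power of [1/s] because [e^x >= x^n / n!] for [x = a / s]. The
    inductive claim [key] carries an extra factor [s^-1 ^+ n] with [n] arbitrary, since Horner's
    step moves a factor ['X] into it. Applied to [P * 'X^2], the bound says that [bump a P s] is at
    most [C * s ^+ 2] in absolute value. *)
Lemma bump_bound {R : realType} (a : R) (P : {poly R}) : 0 < a ->
  exists2 C : R, 0 <= C & forall s, `|bump a P s| <= C.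
Proof.
move=> a0; elim/poly_ind: P => [|P c [C C0 PC]].
  by exists 0 => // s; rewrite /bump horner0 mul0r; case: ifP; rewrite normr0.
have mono n (s : R) : 0 < s -> s^-1 ^+ n.+1 * expR (- (a / s)) <= n.+1`!%:R / a ^+ n.+1.
  move=> s0; rewrite expRN ler_pdivrMr ?expR_gt0//.
  have as0 : 0 <= a / s by rewrite divr_ge0 // ltW.
  have := expR_ge1Dxn n as0; set e := expR _ => H.
  have : (a / s) ^+ n.+1 / n.+1`!%:R <= e by apply: le_trans H; rewrite lerDr.
  rewrite exprMn ler_pdivrMr ?ltr0n ?fact_gt0// => H2.
  rewrite mulrAC ler_pdivlMr ?exprn_gt0//.
  by rewrite [leLHS]mulrC [leRHS]mulrC.
have {mono} key Q n : exists2 D : R, 0 <= D &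
    forall s : R, 0 < s -> `|Q.[s^-1] * s^-1 ^+ n * expR (- (a / s))| <= D.
  elim/poly_ind: Q n => [|Q d IH] n.
    by exists 0 => // s s0; rewrite horner0 !mul0r normr0.
  have [D D0 HD] := IH n.+1.
  exists (D + `|d| * (n`!%:R / a ^+ n + 1)).
    by rewrite addr_ge0// mulr_ge0// addr_ge0// divr_ge0// exprn_ge0// ltW.
  move=> s s0.
  rewrite hornerMXaddC !mulrDl (le_trans (ler_normD _ _))// lerD//.
    by rewrite -[X in `|X * _|]mulrA -exprS HD.
  rewrite -mulrA normrM ler_wpM2l// ger0_norm; last first.
    by rewrite mulr_ge0 ?expR_ge0// exprn_ge0// invr_ge0 ltW.
  case: n {HD} => [|n]; last by rewrite (le_trans (mono _ _ s0))// lerDl.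
  rewrite !expr0 mul1r (@le_trans _ _ 1)//; first by rewrite expR_le1 oppr_le0 divr_ge0// ltW.
  by rewrite fact0 divr1 lerDl.
have [D D0 HD] := key (P * 'X + c%:P) 0%N.
exists D => // s; rewrite /bump; case: ifP => [s0|_]; last by rewrite normr0.
by have := HD _ s0; rewrite expr0 mulr1.
Qed.

(** With [x = 1/s], [dx/ds = - x^2], so the derivative of [P(x) e^(-a x)] in [s] is
    [(a P(x) - P'(x)) x^2 e^(-a x)]. *)
Definition bump_deriv_poly {R : realType} (a : R) (P : {poly R}) : {poly R} :=
  (a *: P - P^`()) * 'X^2.

Lemma is_derive_bump {R : realType} (a : R) (P : {poly R}) (s : R) : 0 < a ->
  is_derive s 1 (bump a P) (bump a (bump_deriv_poly a P) s).
Proof.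
move=> a0; have [s0|s0] := ltP 0 s.
  have sn0 : s != 0 by rewrite gt_eqF.
  have di : is_derive s 1 (fun t : R => t^-1) (- s ^- 2).
    apply: is_derive_eq; first exact: (@is_deriveV _ id).
    by rewrite scaler1.
  have dN : is_derive s 1 (fun t : R => - (a / t)) (a * s ^- 2).
    have := is_deriveN (is_deriveZ a di).
    by rewrite scalerN opprK.
  have dB : is_derive s 1 (fun t : R => P.[t^-1] * expR (- (a / t)))
      (bump a (bump_deriv_poly a P) s).
    have d1 := @is_derive1_comp _ (horner P) (fun t => t^-1) s _ _ (is_derive_poly _ _) di.
    have d2 := @is_derive1_comp _ expR (fun t => - (a / t)) s _ _ (is_derive_expR _) dN.
    apply: (is_derive_eq (is_deriveM d1 d2)).
    rewrite /bump s0 /bump_deriv_poly !hornerE /= /GRing.scale/=; by field.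
  apply: near_eq_is_derive dB.
  near=> t; rewrite /bump ifT//.
  by near: t; exact: lt_nbhsr.
(* For [s <= 0] only the increments with [h + s > 0] count, and then [0 < h + s <= h]. The value is
   thus at most [C * h ^+ 2] and the difference quotient tends to 0; this treats [s < 0] and the
   junction [s = 0] together. *)
have [C C0 HC] := bump_bound a (P * 'X^2) a0.
have bq h : `|bump a P (h + s)| <= C * h ^+ 2.
  rewrite {1}/bump; case: ifP => hs; last first.
    by rewrite normr0 mulr_ge0// sqr_ge0.
  have := HC (h + s); rewrite /bump hs hornerM hornerXn.
  have -> : P.[(h + s)^-1] * (h + s)^-1 ^+ 2 * expR (- (a / (h + s))) =
     (P.[(h + s)^-1] * expR (- (a / (h + s)))) / (h + s) ^+ 2.
    by rewrite mulrAC exprVn.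
  rewrite normrM normfV [`|(h + s) ^+ 2|]ger0_norm ?sqr_ge0//.
  rewrite ler_pdivrMr ?exprn_gt0// => /le_trans; apply.
  have hsh : h + s <= h by rewrite gerDl.
  have h0 : 0 <= h by rewrite (le_trans (ltW hs)).
  by rewrite ler_wpM2l// ler_pXn2r// nnegrE ltW.
have b0 Q : bump a Q s = 0 by rewrite /bump ltNge s0.
have L : h^-1 *: (bump a P (h *: 1 + s) - bump a P s) @[h --> (0 : R)^'] --> 0.
  apply/cvgr0Pnorm_lt => e e0; near=> h.
  have h0 : h != 0 by near: h; exact: nbhs_dnbhs_neq.
  rewrite (b0 P) subr0 normrZ normfV mulrC ltr_pdivrMr ?normr_gt0//.
  rewrite [h *: 1]mulr1 (le_lt_trans (bq h))// -[h ^+ 2]ger0_norm ?sqr_ge0// normrX expr2.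
  rewrite mulrA ltr_pM2r ?normr_gt0//.
  rewrite (@le_lt_trans _ _ ((C + 1) * `|h|))//.
    by rewrite ler_wpM2r// lerDl.
  rewrite mulrC -ltr_pdivlMr; last by rewrite ltr_wpDl.
  near: h; apply: dnbhs0_lt; by rewrite divr_gt0// ltr_wpDl.
rewrite b0; apply: DeriveDef; first by apply/cvg_ex; exists 0.
exact: cvg_lim L.
Unshelve. all: end_near.
Qed.

(* A class closed under partial derivatives, hence made of smooth functions. *)
Inductive elementary {R : realType} : (R * R -> R) -> Prop :=
| elementary_cst c : elementary (fun=> c)
| elementary_fst : elementary fst
| elementary_snd : elementary snd
| elementaryD f g : elementary f -> elementary g -> elementary (f \+ g)
| elementaryM f g : elementary f -> elementary g -> elementary (f \* g)
| elementary_bump a P f : 0 < a -> elementary f -> elementary (bump a P \o f).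

Lemma continuous_linear_diff {R : realType} (f : R * R -> R) p v :
  linear f -> continuous f -> differentiable f p /\ 'D_v f p = f v.
Proof.
move=> lf cf.
pose fM := GRing.isLinear.Build R (R * R)%type R^o _ f lf.
pose fL : {linear (R * R)%type -> R^o} := HB.pack f fM.
have df : differentiable f p by exact: (@linear_differentiable _ _ _ fL).
by split => //; rewrite deriveE// (@diff_lin _ _ _ fL).
Qed.

Lemma elementary_differentiable {R : realType} (f : R * R -> R) p :
  elementary f -> differentiable f p.
Proof.
move=> ef; elim: ef p => {f}[c|||f g _ df _ dg|f g _ df _ dg|a P f a0 _ df] p.
- exact: differentiable_cst.
- apply: (@continuous_linear_diff R fst p 0 _ _).1 => // q; exact: cvg_fst.
- apply: (@continuous_linear_diff R snd p 0 _ _).1 => // q; exact: cvg_snd.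
- exact: differentiableD.
- exact: differentiableM.
- apply: differentiable_comp => //; apply/derivable1_diffP.
  by have [] := is_derive_bump a P (f p) a0.
Qed.

Lemma elementary_derivable {R : realType} (f : R * R -> R) p v :
  elementary f -> derivable f p v.
Proof. by move=> ef; apply: diff_derivable; exact: elementary_differentiable. Qed.

Lemma partialD {R : realType} i (f g : R * R -> R) :
  (forall p, derivable f p (unit_vector i)) ->
  (forall p, derivable g p (unit_vector i)) ->
  partial i (f \+ g) = partial i f \+ partial i g.
Proof. by move=> df dg; apply/funext => p; rewrite /partial deriveD. Qed.

Lemma partialM {R : realType} i (f g : R * R -> R) :
  (forall p, derivable f p (unit_vector i)) ->
  (forall p, derivable g p (unit_vector i)) ->
  partial i (f \* g) = (f \* partial i g) \+ (g \* partial i f).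
Proof. by move=> df dg; apply/funext => p; rewrite /partial deriveM. Qed.

Lemma partial_cst {R : realType} i (c : R) : partial i (fun=> c) = fun=> 0.
Proof. by apply/funext => p; exact: derive_cst. Qed.

Lemma partial_fst {R : realType} i : partial i (@fst R R) = fun=> (i == 0)%:R.
Proof.
apply/funext => p.
rewrite /partial (continuous_linear_diff _ p (unit_vector i) _ _).2//.
  by rewrite /unit_vector; case: ifP.
by move=> q; exact: cvg_fst.
Qed.

Lemma partial_snd {R : realType} i : partial i (@snd R R) = fun=> (i != 0)%:R.
Proof.
apply/funext => p.
rewrite /partial (continuous_linear_diff _ p (unit_vector i) _ _).2//.
  by rewrite /unit_vector; case: ifP.
by move=> q; exact: cvg_snd.
Qed.

Lemma partial_bump {R : realType} i (a : R) (P : {poly R}) (f : R * R -> R) : 0 < a ->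
  (forall p, differentiable f p) ->
  partial i (bump a P \o f) = (bump a (bump_deriv_poly a P) \o f) \* partial i f.
Proof.
move=> a0 df; apply/funext => p; rewrite /partial.
have [db dbE] := is_derive_bump a P (f p) a0.
have dfb : differentiable (bump a P) (f p) by apply/derivable1_diffP.
rewrite !deriveE//; last exact: differentiable_comp.
rewrite diff_comp//= deriv1E//.
by rewrite derive1E dbE -deriveE// [LHS]mulrC.
Qed.

Lemma elementary_partial {R : realType} i (f : R * R -> R) :
  elementary f -> elementary (partial i f).
Proof.
elim=> {f}[c|||f g ef ef' eg eg'|f g ef ef' eg eg'|a P f a0 ef ef'].
- rewrite partial_cst; exact: elementary_cst.
- rewrite partial_fst; exact: elementary_cst.
- rewrite partial_snd; exact: elementary_cst.
- rewrite partialD; [|by move=> ?; exact: elementary_derivable..].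
  exact: elementaryD.
- rewrite partialM; [|by move=> ?; exact: elementary_derivable..].
  by apply: elementaryD; exact: elementaryM.
- rewrite partial_bump//; last by move=> ?; exact: elementary_differentiable.
  by apply: elementaryM => //; exact: elementary_bump.
Qed.

Lemma elementary_smooth {R : realType} (f : R * R -> R) : elementary f -> smooth f.
Proof.
move=> ef s; have {ef} : elementary (iter_partial s f).
  by elim: s => //= i s; exact: elementary_partial.
move=> e; split=> [p i|p]; first exact: elementary_derivable.
exact/differentiable_continuous/elementary_differentiable.
Qed.

(** * Integration by parts in the plane *)

(** The sigma-algebra is the product one, so the open set is exhibited as a countable union of
    squares with rational centre and radius [1/(n+1)], those that it does not contain being replaced
    by [set0]. As [2/(n+1) <= e], a square that contains a point stays within distance [e] of it. *)
Lemma open_measurable_plane {R : realType} (U : set (R * R)) :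
  open U -> measurable (U : set (plane R)).
Proof.
move=> oU.
pose B (q : rat * rat * nat) : set (R * R) :=
  ball (ratr q.1.1 : R) q.2.+1%:R^-1 `*` ball (ratr q.1.2 : R) q.2.+1%:R^-1.
pose C q := if `[< B q `<=` U >] then B q else set0.
have -> : U = \bigcup_q C q.
  apply/seteqP; split => [[x y] Uxy|p [q _]]; last first.
    by rewrite /C; case: ifPn => // /asboolP; exact.
  have /nbhs_ballP[e /= e0 xyU] := oU _ Uxy.
  pose n := Num.trunc (2 / e).
  have n0 : 0 < (n.+1%:R : R)^-1 by rewrite invr_gt0.
  have ne : 2 * n.+1%:R^-1 < e.
    by rewrite ltr_pdivrMr// mulrC -ltr_pdivrMr// truncnS_gt.
  have {}ne : n.+1%:R^-1 + n.+1%:R^-1 <= e.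
    by rewrite -mulr2n -[leLHS]mulr_natl ltW.
  have rapprox (t : R) : exists r : rat, ball t n.+1%:R^-1 (ratr r : R).
    have /rat_in_itvoo[r] : t - n.+1%:R^-1 < t + n.+1%:R^-1.
      by rewrite ltrBlDr -addrA ltrDl addr_gt0.
    by exists r; rewrite ball_itv.
  have [r rx] := rapprox x; have [s sy] := rapprox y.
  exists (r, s, n) => //; rewrite /C ifT.
    by split; apply: ball_sym.
  apply/asboolP => -[x' y'] [/= x'r y's]; apply: xyU; split => /=.
    exact: (le_ball ne (ball_triangle rx x'r)).
  exact: (le_ball ne (ball_triangle sy y's)).
apply: countable_bigcupT_measurable => [|q]; first exact: countableP.
rewrite /C; case: ifP => _ //; apply: measurableX; exact: measurable_ball.
Qed.

Lemma continuous_measurable_plane {R : realType} (f : R * R -> R) :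
  continuous f -> measurable_fun [set: plane R] f.
Proof.
move=> /continuousP cf.
apply: (measurability _ (RGenOpens.measurableE R)) => _ [_ [a [b ->] <-]].
rewrite setTI; apply: open_measurable_plane; apply: cf; exact: interval_open.
Qed.

Lemma measurable_sup_ball {R : realType} (M : R) :
  measurable ([set p | `|p| < M] : set (plane R)).
Proof.
apply: open_measurable_plane.
have -> : [set p : R * R | `|p| < M] = ball (0 : R * R) M.
  by apply/seteqP; split => p /=; rewrite -ball_normE /ball_ /= sub0r normrN.
exact: ball_open.
Qed.

Lemma area_ball_lty {R : realType} (M : R) : (area [set p : R * R | (`|p| < M)%R] < +oo)%E.
Proof.
apply: (@le_lt_trans _ _ (area (`[- M, M]%classic `*` `[- M, M]%classic))).
  apply: le_measure; rewrite ?inE.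
  - exact: measurable_sup_ball.
  - by apply: measurableX; exact: measurable_itv.
  - move=> [x y] /=; rewrite prod_normE /= gt_max !in_itv/= => /andP[].
    by rewrite !ltr_norml => /andP[/ltW-> /ltW->] /andP[/ltW-> /ltW->].
rewrite /area product_measure1E//; try exact: measurable_itv.
by rewrite /= !lebesgue_measure_itv /=; case: ifP => _; rewrite ?mule0 -?EFinB -?EFinM ltry.
Qed.

Lemma compact_support_integrable {R : realType} (f : R * R -> R) (K : set (R * R)) :
  continuous f -> compact K -> (forall p, ~ K p -> f p = 0) ->
  area.-integrable setT (EFin \o f).
Proof.
move=> cf cK fK.
have [M [Mr KM]] := compact_bounded cK.
have cfK : compact (f @` K).
  by apply: continuous_compact => //; exact: continuous_subspaceT.
have [N [Nr fN]] := compact_bounded cfK.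
(* [compact_bounded] only makes the numbers strictly above [M] bounds of [K]: [|M| + 1] is one, and
   [|M| + 2] turns the bound into the strict inequality of [D]. *)
pose D := [set p : R * R | `|p| < `|M| + 2].
have mD := @measurable_sup_ball R (`|M| + 2).
have -> : EFin \o f = ((EFin \o f) \_ D)%E.
  apply/funext => p; rewrite patchE; case: ifPn => // /negP; rewrite inE => Dp.
  rewrite /= fK// => Kp; apply: Dp; rewrite /D /=.
  rewrite (@le_lt_trans _ _ (`|M| + 1))//; last by rewrite ltrD2l ltr1n.
  by apply: KM => //; rewrite (le_lt_trans (ler_norm M))// ltrDl.
apply: (integrable_mkcond _ mD).1.
apply: measurable_bounded_integrable => //.
- exact: area_ball_lty.
- apply: measurable_funTS; exact: continuous_measurable_plane.
- exists (Num.max 0 N); split; first by rewrite max_real// realE lexx.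
  move=> x; rewrite gt_max => /andP[x0 Nx] p _ /=.
  have [Kp|Kp] := pselect (K p); first by apply: fN => //; exists p.
  by rewrite fK// normr0 ltW.
Qed.

Lemma integral_deriv_vanishing {R : realType} (F : R -> R) (M : R) :
  (forall t, derivable F t 1) -> continuous (F^`())%classic ->
  (forall t, M <= `|t| -> F t = 0 /\ (F^`())%classic t = 0) ->
  (\int[lebesgue_measure]_t ((F^`())%classic t)%:E = 0)%E.
Proof.
move=> dF cF' F0.
(* [N] is positive, so that [[-N, N]] is nondegenerate, and at least [M], so that [F] vanishes at
   both ends. *)
pose N := `|M| + 1.
have N0 : 0 < N by rewrite ltr_wpDl.
have MN : M <= N by rewrite (le_trans (ler_norm M))// lerDl.
transitivity (\int[lebesgue_measure]_(t in `[(- N)%R, N]) ((F^`())%classic t)%:E)%E.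
  rewrite [RHS]integral_mkcond; apply: eq_integral => t _.
  rewrite patchE; case: ifPn => // /negP; rewrite inE/= in_itv/= => tN.
  rewrite (F0 t _).2//; have [//|tM] := leP M `|t|.
  exfalso; by apply: tN; rewrite -ler_norml (le_trans (ltW tM)).
have cF : continuous F.
  by move=> t; apply: differentiable_continuous; apply/derivable1_diffP.
rewrite (@continuous_FTC2 _ _ F).
- by rewrite !(F0 _ _).1 ?subee//= ?normrN (ger0_norm (ltW N0)).
- by rewrite gtrN.
- exact: continuous_subspaceT.
- split=> [t _//||]; [apply: cvg_at_right_filter|apply: cvg_at_left_filter]; exact: cF.
- by [].
Qed.

Lemma unit_vector_shift {R : realType} i (h x y : R) :
  h *: unit_vector i + (x, y) =
  if i == 0 then (h *: (1 : R) + x, y) else (x, h *: (1 : R) + y).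
Proof.
rewrite /unit_vector; case: ifP => _.
- by rewrite -[h *: (1, 0)]/(h *: (1 : R), h *: (0 : R)) scaler0
    -[LHS]/(h *: (1 : R) + x, 0 + y) add0r.
- by rewrite -[h *: (0, 1)]/(h *: (0 : R), h *: (1 : R)) scaler0
    -[LHS]/(0 + x, h *: (1 : R) + y) add0r.
Qed.

(** A shift along a unit vector fixes the other coordinate, so the two difference quotients coincide
    as functions of [h], before any limit is taken. *)
Lemma derive_slice {R : realType} i (f : R * R -> R) x y :
  'D_(unit_vector i) f (x, y) =
  if i == 0 then 'D_1 (fun t => f (t, y)) x else 'D_1 (fun t => f (x, t)) y.
Proof.
rewrite /derive; under eq_fun do rewrite /= unit_vector_shift.
by case: ifP.
Qed.

Lemma derivable_slice {R : realType} i (f : R * R -> R) x y :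
  derivable f (x, y) (unit_vector i) ->
  if i == 0 then derivable (fun t => f (t, y)) x 1 else derivable (fun t => f (x, t)) y 1.
Proof.
rewrite /derivable; under eq_fun do rewrite /= unit_vector_shift.
by case: ifP.
Qed.

(** By Fubini, integrating first along the direction of differentiation: the inner integral is that
    of the derivative of a slice that vanishes far away, hence 0. The order of integration therefore
    depends on [i]. *)
Lemma integral_partial_compact {R : realType} i (f : R * R -> R) (K : set (R * R)) :
  (forall p, derivable f p (unit_vector i)) -> continuous (partial i f) ->
  compact K -> (forall p, ~ K p -> f p = 0 /\ partial i f p = 0) ->
  (\int[area]_p (partial i f p)%:E = 0)%E.
Proof.
move=> df cf cK fK.
have fint := compact_support_integrable _ _ cf cK (fun p nK => (fK p nK).2).
have [M [Mr KM]] := compact_bounded cK.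
have f0 p : M + 1 < `|p| -> f p = 0 /\ partial i f p = 0.
  move=> Mp; apply: fK => Kp; have := KM (M + 1).
  by rewrite ltrDl ltr01 => /(_ isT _ Kp) /=; rewrite leNgt Mp.
have [i0|i0] := boolP (i == 0).
- rewrite -integral21_prod_meas1//; apply: integral0_eq => y _.
  rewrite /fubini_G /=.
  have F'E : (fun t => f (t, y))^`()%classic = fun t => partial i f (t, y).
    by apply/funext => t; rewrite derive1E /partial derive_slice i0.
  have := @integral_deriv_vanishing _ (fun t => f (t, y)) (M + 2); rewrite F'E; apply.
  + by move=> t; have := derivable_slice _ _ _ _ (df (t, y)); rewrite i0.
  + move=> t; apply: (@continuous_comp _ _ _ (fun t => (t, y)) (partial i f)); last exact: cf.
    by apply: (@cvg_pair _ _ _ _ (nbhs t) (nbhs y)); [exact: cvg_id|exact: cvg_cst].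
  + move=> t Mt; apply: f0; rewrite prod_normE lt_max (lt_le_trans _ Mt)//.
    by rewrite ltrD2l ltr1n.
- rewrite -integral12_prod_meas1//; apply: integral0_eq => x _.
  rewrite /fubini_F /=.
  have F'E : (fun t => f (x, t))^`()%classic = fun t => partial i f (x, t).
    by apply/funext => t; rewrite derive1E /partial derive_slice (negbTE i0).
  have := @integral_deriv_vanishing _ (fun t => f (x, t)) (M + 2); rewrite F'E; apply.
  + by move=> t; have := derivable_slice _ _ _ _ (df (x, t)); rewrite (negbTE i0).
  + move=> t; apply: (@continuous_comp _ _ _ (fun t => (x, t)) (partial i f)); last exact: cf.
    by apply: (@cvg_pair _ _ _ _ (nbhs x) (nbhs t)); [exact: cvg_cst|exact: cvg_id].
  + move=> t Mt; apply: f0; rewrite prod_normE lt_max orbC (lt_le_trans _ Mt)//.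
    by rewrite ltrD2l ltr1n.
Qed.

Lemma smooth_derivable {R : realType} (f : R * R -> R) :
  smooth f -> forall p i, derivable f p (unit_vector i).
Proof. by move=> sf; have [] := sf [::]. Qed.

Lemma smooth_continuous {R : realType} (f : R * R -> R) : smooth f -> continuous f.
Proof. by move=> sf; have [] := sf [::]. Qed.

Lemma smooth_continuous_partial {R : realType} i (f : R * R -> R) :
  smooth f -> continuous (partial i f).
Proof. by move=> sf; have [] := sf [:: i]. Qed.

(** The complement of a closure is open, so [f] is zero on a whole neighbourhood of [p] and its
    derivatives vanish with it. *)
Lemma vanishing_off_support {R : realType} (f : R * R -> R) p :
  ~ Defs.support f p -> f p = 0 /\ forall i, partial i f p = 0.
Proof.
move=> fp; have : (~` Defs.support f) p by exact: fp.
rewrite /Defs.support -interiorC => f0; have {}f0 : \forall q \near p, f q = cst 0 q.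
  by apply: filterS f0 => q /negP; rewrite negbK => /eqP.
split=> [|i]; first exact: nbhs_singleton f0.
by rewrite /partial (near_eq_derive _ f0) derive_cst.
Qed.

Lemma integral_on_supported {R : realType} (O : set (R * R)) (f : R * R -> R) :
  (forall p, ~ O p -> f p = 0) -> integral_on O f = integral_on setT f.
Proof.
move=> fO; rewrite /integral_on Rintegral_mkcond; congr (Rintegral _ _ _).
apply/funext => p; rewrite patchE; case: ifPn => // /negP; rewrite inE => Op.
by rewrite fO.
Qed.

(** The product [g \* phi] has compact support, so the integral of its partial derivative over the
    plane is 0. Passing from [O] to the plane is harmless as [phi] and its derivatives vanish off
    [O]. *)
Lemma integral_on_by_parts {R : realType} (O : set (R * R)) (phi g : R * R -> R) i :
  test_function O phi -> smooth g ->
  integral_on O (fun p => g p * partial i phi p) =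
  - integral_on O (fun p => partial i g p * phi p).
Proof.
move=> [sphi cphi phiO] sg.
have cont (f h : R * R -> R) : continuous f -> continuous h -> continuous (fun p => f p * h p).
  by move=> cf ch p; apply: continuousM; [exact: cf|exact: ch].
have off p : ~ Defs.support phi p -> phi p = 0 /\ partial i phi p = 0.
  by move=> /vanishing_off_support[-> ->].
rewrite !integral_on_supported; first last.
- by move=> p Op; rewrite (off p _).2 ?mulr0// => /phiO.
- by move=> p Op; rewrite (off p _).1 ?mulr0// => /phiO.
have cg' := smooth_continuous_partial i _ sg.
have cphi' := smooth_continuous_partial i _ sphi.
have cg := smooth_continuous _ sg.
have cp := smooth_continuous _ sphi.
apply/eqP; rewrite -addr_eq0 /integral_on -RintegralD//; first last.
- apply: (compact_support_integrable _ _ _ cphi) => [|p]; first exact: cont.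
  by move=> /off[-> _]; rewrite mulr0.
- apply: (compact_support_integrable _ _ _ cphi) => [|p]; first exact: cont.
  by move=> /off[_ ->]; rewrite mulr0.
have dg := smooth_derivable _ sg; have dp := smooth_derivable _ sphi.
have E : partial i (g \* phi) = fun p => g p * partial i phi p + partial i g p * phi p.
  by rewrite (partialM _ _ _ (dg^~ i) (dp^~ i)); apply/funext => p /=; rewrite [X in _ + X]mulrC.
have := integral_partial_compact i (g \* phi) (Defs.support phi).
rewrite E /Rintegral => ->.
- by [].
- by move=> p; apply: derivableM.
- by move=> p; apply: cvgD; [exact: (cont _ _ cg cphi')|exact: (cont _ _ cg' cp)].
- exact: cphi.
- by move=> p /off[p0 p0']; rewrite /= p0 p0' !mulr0 addr0.
Qed.

(** * The area of a triangle *)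

Definition affine_map {R : realType} (a b : R) : measurableTypeR R -> measurableTypeR R :=
  fun t => a * t + b.

Lemma measurable_affine_map {R : realType} (a b : R) :
  measurable_fun setT (affine_map a b).
Proof. by apply: measurable_funD => //; exact: measurable_funM. Qed.

Definition swap_pair {R : realType} (p : plane R) :
  plane R := (p.2, p.1).

Lemma measurable_swap_pair {R : realType} : measurable_fun setT (@swap_pair R).
Proof. by apply: measurable_fun_pair. Qed.

(** The pushforward scaled by [|a|] agrees with Lebesgue measure on the intervals []u, v]], which
    determine it. For [a < 0] the preimage of such an interval is closed on the left instead. *)
Lemma lebesgue_measure_affine {R : realType} (a b : R) (A : set R) : a != 0 ->
  measurable (A : set (measurableTypeR R)) ->
  (`|a|%:E * lebesgue_measure (affine_map a b @^-1` A) = lebesgue_measure A)%E.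
Proof.
move=> a0 mA.
pose r := NngNum (normr_ge0 a).
pose m : {measure set (measurableTypeR R) -> \bar R} :=
  mscale r (measure_function_pushforward__canonical__measure_function_Measure lebesgue_measure
    (measurable_affine_map a b)).
apply/esym; rewrite (@lebesgue_measure_unique _ m)//= => _ [[u v] _ <-].
rewrite /m /mscale /pushforward /= !lebesgue_measure_itv/=.
have [a_gt0|a_lt0|a00] := ltgtP 0 a; last by rewrite -a00 eqxx in a0.
- rewrite [X in (_ * lebesgue_measure X)%E](_ : _ =
    `](u - b) / a, (v - b) / a]%classic); last first.
    apply/seteqP; split => t; rewrite /affine_map /= !in_itv/= ltr_pdivrMr// ler_pdivlMr//;
      by rewrite ltrBlDr lerBrDr [t * a]mulrC.
  rewrite lebesgue_measure_itv/= !lte_fin ltr_pM2r ?invr_gt0// ltrD2r.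
  case: ifP => _; rewrite ?mule0// -!EFinB -EFinM gtr0_norm//; congr EFin.
  by field.
- rewrite [X in (_ * lebesgue_measure X)%E](_ : _ =
    `[(v - b) / a, (u - b) / a[%classic); last first.
    apply/seteqP; split => t; rewrite /affine_map /= !in_itv/= ltr_ndivlMr// ler_ndivrMr//;
      by rewrite ltrBlDr lerBrDr [t * a]mulrC andbC.
  rewrite lebesgue_measure_itv/= !lte_fin ltr_nM2r ?invr_lt0// ltrD2r.
  case: ifP => _; rewrite ?mule0// -!EFinB -EFinM ltr0_norm//; congr EFin.
  by field.
Qed.

(** Both sides are measures in [S] with the same values on rectangles, and these determine a product
    measure. *)
Lemma area_swap {R : realType} (S : set (R * R)) :
  measurable (S : set (plane R)) ->
  area (swap_pair @^-1` S) = area S.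
Proof.
move=> mS.
pose m : {measure set (plane R) -> \bar R} :=
  measure_function_pushforward__canonical__measure_function_Measure area
    measurable_swap_pair.
rewrite [RHS](@product_measure_unique _ _ _ _ _ _ _ m)// => A B mA mB.
transitivity (area (B `*` A)).
  by congr (area _); apply/seteqP; split => -[x y] [].
by rewrite /area product_measure1E// muleC.
Qed.

(** A triangular affine map of determinant [b] that preserves each vertical line. *)
Definition fiber_affine {R : realType} (a b c : R)
    (p : plane R) :
    plane R :=
  (p.1, a * p.1 + b * p.2 + c).

Lemma measurable_fiber_affine {R : realType} (a b c : R) :
  measurable_fun setT (fiber_affine a b c).
Proof.
apply: measurable_fun_pair => //.
apply: measurable_funD => //.
by apply: measurable_funD; exact: measurable_funM.
Qed.

(** The area integrates the lengths of the sections at fixed [x]; each of them is transformed by an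
    affine map of slope [b], with a shift [a * x + c] that does not affect lengths. *)
Lemma area_fiber_affine {R : realType} (a b c : R) (S : set (R * R)) : b != 0 ->
  measurable (S : set (plane R)) ->
  (`|b|%:E * area (fiber_affine a b c @^-1` S) = area S)%E.
Proof.
move=> b0 mS; rewrite /area /product_measure1.
have mS' : measurable (fiber_affine a b c @^-1` S).
  by rewrite -[X in measurable X]setTI; apply: measurable_fiber_affine.
rewrite -ge0_integralZl//; last exact: measurable_fun_xsection.
apply: eq_integral => x _ /=.
rewrite -(lebesgue_measure_affine _ (a * x + c) (xsection S x) b0); last exact: measurable_xsection.
congr (_ * lebesgue_measure _)%E; apply/seteqP; split => y;
  by rewrite /xsection /affine_map /fiber_affine /= !inE/= addrAC addrC addrA.
Qed.

Lemma area_unit_triangle {R : realType} :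
  area [set p : R * R | [/\ 0 < p.1, 0 < p.2 & p.1 + p.2 < 1]] = (2^-1)%:E.
Proof.
rewrite /area /product_measure1 /=.
transitivity (\int[@lebesgue_measure R]_(x in `](0 : R)%R, 1%R[) (1 - x)%:E)%E.
  rewrite [RHS]integral_mkcond; apply: eq_integral => x _ /=; rewrite patchE.
  case: ifPn => [|/negP]; rewrite inE/= in_itv/= => x01.
    rewrite [X in lebesgue_measure X](_ : _ = `]0, 1 - x[%classic).
      by rewrite lebesgue_measure_itv/= lte_fin subr_gt0 (andP x01).2 oppr0 adde0.
    apply/seteqP; split => y; rewrite /xsection /= inE/= in_itv/=.
      by move=> [_ -> xy]; rewrite ltrBrDl.
    by move=> /andP[-> y1]; split => //; [exact: (andP x01).1|rewrite -ltrBrDl].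
  rewrite [X in lebesgue_measure X](_ : _ = set0) ?measure0//.
  apply/seteqP; split => y //; rewrite /xsection /= inE/= => -[x0 y0 xy].
  by apply: x01; rewrite x0/= (lt_trans _ xy)// ltrDl.
have cf : continuous (fun x : R => 1 - x).
  by move=> x; apply: cvgB; [exact: cvg_cst|exact: cvg_id].
have mf : measurable_fun [set: measurableTypeR R] (EFin \o (fun x : R => 1 - x)).
  by apply/measurable_EFinP; exact: continuous_measurable_fun.
rewrite integral_itv_bndo_bndc; last exact: measurable_funTS.
rewrite integral_itv_obnd_cbnd; last exact: measurable_funTS.
pose P : {poly R} := 'X - 2^-1 *: 'X^2.
have dP (x : R) : is_derive x 1 (horner P) (1 - x).
  apply: is_derive_eq; rewrite /P derivB derivX derivZ derivXn !hornerE /=; lra.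
have cP : continuous (horner P) by exact: continuous_horner.
rewrite (@continuous_FTC2 _ _ (horner P))//.
- by rewrite /P !hornerE -EFinB; congr EFin => /=; lra.
- exact: continuous_subspaceT.
- split=> [x _||]; first by have [] := dP x.
  + by apply: cvg_at_right_filter; exact: cP.
  + by apply: cvg_at_left_filter; exact: cP.
- by move=> x _; rewrite derive1E; have [] := dP x.
Qed.

Lemma measurable_unit_triangle {R : realType} :
  measurable ([set p | [/\ 0 < p.1, 0 < p.2 & p.1 + p.2 < 1]] :
    set (plane R)).
Proof.
apply: open_measurable_plane.
have c1 : continuous (fst : R * R -> R) by move=> p; exact: cvg_fst.
have c2 : continuous (snd : R * R -> R) by move=> p; exact: cvg_snd.
rewrite (_ : [set p | _] = (fst @^-1` [set t : R | 0 < t] `&`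
  snd @^-1` [set t : R | 0 < t] `&` (fun p : R * R => p.1 + p.2) @^-1` [set t | t < 1])).
  apply: openI; first by apply: openI; apply: open_comp => //; exact: open_gt.
  by apply: open_comp => [p _|]; [apply: cvgD; [exact: c1|exact: c2]|exact: open_lt].
by apply/seteqP; split => p /=; [case=> ? ? ?|case=> -[? ?] ?].
Qed.

(* Two fiberwise affine changes of variables, separated by a swap of the
   coordinates, carry the set to the unit triangle. *)
Lemma area_affine_triangle {R : realType} (a1 b1 c1 a2 b2 c2 : R) :
  a1 * b2 - a2 * b1 != 0 ->
  (`|a1 * b2 - a2 * b1|%:E * area [set p : R * R |
    [/\ (0 < a1 * p.1 + b1 * p.2 + c1)%R, (0 < a2 * p.1 + b2 * p.2 + c2)%R &
    ((a1 * p.1 + b1 * p.2 + c1) + (a2 * p.1 + b2 * p.2 + c2) < 1)%R]] = (2^-1)%:E)%E.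
Proof.
(* The set is symmetric in the two forms, and [b1], [b2] cannot both be 0 since the determinant is
   not. *)
wlog b10 : a1 b1 c1 a2 b2 c2 / b1 != 0.
  move=> H D0; have [b10|] := eqVneq b1 0; last by move=> /H; exact.
  have b20 : b2 != 0 by move: D0; apply: contra_neq => ->; rewrite b10 !mulr0 subrr.
  rewrite distrC -(H a2 b2 c2 a1 b1 c1 b20); last by rewrite -opprB oppr_eq0.
  congr (_ * area _)%E; apply/seteqP.
  by split => p [? ? ?]; split => //; rewrite addrC.
move=> D0.
pose T0 := [set p : R * R | [/\ 0 < p.1, 0 < p.2 & p.1 + p.2 < 1]].
have mT0 : measurable (T0 : set (plane R)).
  exact: measurable_unit_triangle.
(* With l1, l2 the two affine forms, l2 = alpha * x + beta * l1 + gamma. *)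
pose alpha := a2 - b2 / b1 * a1.
pose beta := b2 / b1.
pose gamma := c2 - b2 / b1 * c1.
have alpha0 : alpha != 0.
  have : (- (a1 * b2 - a2 * b1) / b1 != 0) by rewrite mulf_neq0 ?oppr_eq0// invr_eq0.
  by apply: contra_neq => <-; rewrite /alpha; field.
(* The composite sends [(x, y)] to [(x, l1)], then [(l1, x)], then [(l1, l2)]; its scale factor is
   [b1 * alpha], the opposite of [a1 * b2 - a2 * b1]. *)
pose T1 := fiber_affine beta alpha gamma @^-1` T0.
have mT1 : measurable (T1 : set (plane R)).
  by rewrite -[X in measurable X]setTI; apply: measurable_fiber_affine.
pose T2 := swap_pair @^-1` T1.
have mT2 : measurable (T2 : set (plane R)).
  by rewrite -[X in measurable X]setTI; apply: measurable_swap_pair.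
rewrite -(area_unit_triangle (R := R)) -/T0.
rewrite -(area_fiber_affine beta alpha gamma T0 alpha0 mT0) -/T1.
rewrite -(area_swap T1 mT1) -/T2 -(area_fiber_affine a1 b1 c1 T2 b10 mT2) muleA -EFinM -normrM.
congr (_%:E * area _)%E.
  by rewrite -normrN; congr Num.norm; rewrite /alpha; field.
apply/seteqP; split => -[x y]; rewrite /T2 /T1 /T0 /swap_pair /fiber_affine /=;
  rewrite (_ : beta * (a1 * x + b1 * y + c1) + alpha * x + gamma = a2 * x + b2 * y + c2) //;
  by rewrite /beta /alpha /gamma; field.
Qed.

(** * Barycentric coordinates of an equilateral triangle *)

(** The indices are written with [lift] because this is the form that [big_ord_recl] produces when
    sums and products over ['I_3] are expanded. *)
Lemma forall_ord3 (P : 'I_3 -> Prop) :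
  (forall i, P i) <-> [/\ P ord0, P (lift ord0 ord0) & P (lift ord0 (lift ord0 ord0))].
Proof.
split=> [//|[P0 P1 P2]] [[|[|[|//]]]] lt3.
- by rewrite (_ : Ordinal lt3 = ord0)//; exact/val_inj.
- by rewrite (_ : Ordinal lt3 = lift ord0 ord0)//; exact/val_inj.
- by rewrite (_ : Ordinal lt3 = lift ord0 (lift ord0 ord0))//; exact/val_inj.
Qed.

Lemma sum_ord3 {V : nmodType} (F : 'I_3 -> V) :
  \sum_(i < 3) F i = F ord0 + F (lift ord0 ord0) + F (lift ord0 (lift ord0 ord0)).
Proof. by rewrite !big_ord_recl big_ord0 addr0 addrA. Qed.

Lemma ord3_third (i j : 'I_3) : i != j -> exists k, (k != i) && (k != j).
Proof.
move: i j; apply/forall_ord3; split; apply/forall_ord3; split => // _;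
  by [exists ord0|exists (lift ord0 ord0)|exists (lift ord0 (lift ord0 ord0))].
Qed.

Lemma edistE {R : realType} (p q : R * R) (s : R) : Defs.edist p q = s ->
  (p.1 - q.1) ^+ 2 + (p.2 - q.2) ^+ 2 = s ^+ 2.
Proof. by move=> <-; rewrite /Defs.edist sqr_sqrtr// addr_ge0// sqr_ge0. Qed.

(* (p, q) and (r, t) are the edges leaving one vertex of a triangle of side s. *)
Lemma equilateral_det {R : realType} (p q r t s : R) :
  p ^+ 2 + q ^+ 2 = s ^+ 2 -> r ^+ 2 + t ^+ 2 = s ^+ 2 ->
  (p - r) ^+ 2 + (q - t) ^+ 2 = s ^+ 2 ->
  p * r + q * t = s ^+ 2 / 2 /\ (p * t - q * r) ^+ 2 = 3 / 4 * s ^+ 4.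
Proof.
move=> e1 e2 e3.
have dot : p * r + q * t = s ^+ 2 / 2 by nra.
split => //.
(* Lagrange's identity. *)
have -> : (p * t - q * r) ^+ 2 =
  (p ^+ 2 + q ^+ 2) * (r ^+ 2 + t ^+ 2) - (p * r + q * t) ^+ 2 by ring.
by rewrite e1 e2 dot; field.
Qed.

Lemma cramer2 {R : realType} (a b p q r t u v : R) :
  a * p + b * q = u -> a * r + b * t = v ->
  (p * t - q * r) * a = u * t - q * v /\ (p * t - q * r) * b = p * v - u * r.
Proof. by move=> <- <-; split; ring. Qed.

(** Along the edges leaving the common zero [r], Cramer's rule gives both gradients multiplied by
    the determinant [D]. Their product is then minus the dot product of the two edges, so [D ^+ 2 *
    (a * a' + b * b') = - s ^+ 2 / 2], where [D ^+ 2 = 3 / 4 * s ^+ 4]. *)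
Lemma equilateral_dot {R : realType} (s a b c a' b' c' : R) (p q r : R * R) : 0 < s ->
  Defs.edist p q = s -> Defs.edist p r = s -> Defs.edist q r = s ->
  a * p.1 + b * p.2 + c = 1 -> a * q.1 + b * q.2 + c = 0 -> a * r.1 + b * r.2 + c = 0 ->
  a' * p.1 + b' * p.2 + c' = 0 -> a' * q.1 + b' * q.2 + c' = 1 -> a' * r.1 + b' * r.2 + c' = 0 ->
  a * a' + b * b' = - (2 / (3 * s ^+ 2)).
Proof.
move=> s0 /edistE pq /edistE pr /edistE qr lp lq lr mp mq mr.
have [] := @equilateral_det _ (p.1 - r.1) (p.2 - r.2) (q.1 - r.1) (q.2 - r.2) s pr qr.
  by rewrite -pq; congr (_ ^+ 2 + _ ^+ 2); ring.
set P := p.1 - r.1; set Q := p.2 - r.2; set S := q.1 - r.1; set T := q.2 - r.2 => dot det.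
have [] := @cramer2 _ a b P Q S T 1 0; [rewrite /P /Q; lra|rewrite /S /T; lra|].
have [] := @cramer2 _ a' b' P Q S T 0 1; [rewrite /P /Q; lra|rewrite /S /T; lra|].
set D := P * T - Q * S in det *.
rewrite !mul0r !mul1r !mulr0 !mulr1 !subr0 !sub0r => Da' Db' Da Db.
have s20 : s ^+ 2 != 0 by rewrite expf_neq0// gt_eqF.
have D2 : D ^+ 2 != 0 by rewrite det mulf_neq0 ?expf_neq0 ?gt_eqF// divr_gt0.
apply: (mulfI D2).
have -> : D ^+ 2 * (a * a' + b * b') = (D * a) * (D * a') + (D * b) * (D * b') by ring.
rewrite Da Db Da' Db' det.
have -> : T * - Q + - S * P = - (P * S + Q * T) by ring.
rewrite dot; field. by rewrite gt_eqF.
Qed.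

Lemma affine_zero {R : realType} (a b c : R) (p q r : R * R) :
  (p.1 - r.1) * (q.2 - r.2) - (p.2 - r.2) * (q.1 - r.1) != 0 ->
  a * p.1 + b * p.2 + c = 0 -> a * q.1 + b * q.2 + c = 0 -> a * r.1 + b * r.2 + c = 0 ->
  [/\ a = 0, b = 0 & c = 0].
Proof.
move=> D0 ep eq er.
have [] := @cramer2 _ a b (p.1 - r.1) (p.2 - r.2) (q.1 - r.1) (q.2 - r.2) 0 0.
- lra.
- lra.
rewrite !mul0r !mulr0 subrr => /eqP; rewrite mulf_eq0 (negbTE D0)/= => /eqP a0.
move=> /eqP; rewrite mulf_eq0 (negbTE D0)/= => /eqP b0.
by split => //; move: er; rewrite a0 b0 !mul0r !add0r.
Qed.

Lemma equilateral_det_neq0 {R : realType} (s : R) (p q r : R * R) : 0 < s ->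
  Defs.edist p q = s -> Defs.edist p r = s -> Defs.edist q r = s ->
  (p.1 - r.1) * (q.2 - r.2) - (p.2 - r.2) * (q.1 - r.1) != 0.
Proof.
move=> s0 /edistE pq /edistE pr /edistE qr.
have [] := @equilateral_det _ (p.1 - r.1) (p.2 - r.2) (q.1 - r.1) (q.2 - r.2) s pr qr.
  by rewrite -pq; congr (_ ^+ 2 + _ ^+ 2); ring.
move=> _ det; rewrite -sqrf_eq0 det mulf_neq0 ?expf_neq0 ?gt_eqF// divr_gt0//.
Qed.

Lemma barycentric_coef {R : realType} {z : 'I_3 -> R * R} {lambda : 'I_3 -> R * R -> R}
    (hlambda : barycentric z lambda) : exists a b c : 'I_3 -> R,
  forall i p, lambda i p = a i * p.1 + b i * p.2 + c i.
Proof.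
have H i : exists t : R * R * R, forall p, lambda i p = t.1.1 * p.1 + t.1.2 * p.2 + t.2.
  by have [[a [b [c abc]]] _] := hlambda i; exists (a, b, c).
have [t tE] := choice H.
by exists (fun i => (t i).1.1), (fun i => (t i).1.2), (fun i => (t i).2).
Qed.

(** Uniqueness of affine interpolation: it reduces the identities between affine functions below to
    a check at the three vertices. *)
Lemma affine_zero_on_vertices {R : realType} {z : 'I_3 -> R * R}
    (hz : equilateral z) (a b c : R) :
  (forall j, a * (z j).1 + b * (z j).2 + c = 0) -> [/\ a = 0, b = 0 & c = 0].
Proof.
move=> H; have [s s0 zs] := hz.
apply: (affine_zero _ _ _ _ _ _ _ (H ord0) (H (lift ord0 ord0)) (H (lift ord0 (lift ord0 ord0)))).
by apply: (equilateral_det_neq0 s _ _ _ s0); exact: zs.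
Qed.

Lemma barycentric_vertex {R : realType} {z : 'I_3 -> R * R} {lambda : 'I_3 -> R * R -> R}
    (hlambda : barycentric z lambda) i j : lambda i (z j) = (i == j)%:R.
Proof. exact: (hlambda i).2. Qed.

Lemma barycentric_sum {R : realType} {z : 'I_3 -> R * R} {lambda : 'I_3 -> R * R -> R}
    (hz : equilateral z) (hlambda : barycentric z lambda) p : \sum_(i < 3) lambda i p = 1.
Proof.
have [a [b [c E]]] := barycentric_coef hlambda.
have [] := affine_zero_on_vertices hz (\sum_i a i) (\sum_i b i) (\sum_i c i - 1).
  move=> j; rewrite addrA !mulr_suml -!big_split/=.
  under eq_bigr do rewrite -E (barycentric_vertex hlambda).
  by rewrite (bigD1 j)//= eqxx big1 ?addr0 ?subrr// => i /negbTE ->.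
move=> a0 b0 /eqP; rewrite subr_eq0 => /eqP c1.
under eq_bigr do rewrite E.
by rewrite !big_split/= -!mulr_suml a0 b0 c1 !mul0r !add0r.
Qed.

(** For a linear form [w], the affine function [\sum_i lambda i p * w (z i) - w p] is zero at each
    vertex, so its coefficients vanish. The two coordinates are then taken for [w]. *)
Lemma barycentric_expansion {R : realType} {z : 'I_3 -> R * R} {lambda : 'I_3 -> R * R -> R}
    (hz : equilateral z) (hlambda : barycentric z lambda) p : p = \sum_(i < 3) lambda i p *: z i.
Proof.
have [a [b [c E]]] := barycentric_coef hlambda.
have key (h1 h2 : R) (w := fun q : R * R => h1 * q.1 + h2 * q.2) :
    w p = \sum_(i < 3) lambda i p * w (z i).
  have [] := affine_zero_on_vertices hz (\sum_i a i * w (z i) - h1)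
    (\sum_i b i * w (z i) - h2) (\sum_i c i * w (z i)).
    move=> j; transitivity (\sum_i lambda i (z j) * w (z i) - w (z j)).
      by rewrite !sum_ord3 !E /w; ring.
    under eq_bigr do rewrite (barycentric_vertex hlambda).
    by rewrite (bigD1 j)//= eqxx mul1r big1 ?addr0 ?subrr// => i /negbTE ->; rewrite mul0r.
  rewrite !sum_ord3 => eh1 eh2 ec.
  transitivity (w p + ((a ord0 * w (z ord0) + a (lift ord0 ord0) * w (z (lift ord0 ord0)) +
    a (lift ord0 (lift ord0 ord0)) * w (z (lift ord0 (lift ord0 ord0))) - h1) * p.1 +
    (b ord0 * w (z ord0) + b (lift ord0 ord0) * w (z (lift ord0 ord0)) +
    b (lift ord0 (lift ord0 ord0)) * w (z (lift ord0 (lift ord0 ord0))) - h2) * p.2 +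
    (c ord0 * w (z ord0) + c (lift ord0 ord0) * w (z (lift ord0 ord0)) +
    c (lift ord0 (lift ord0 ord0)) * w (z (lift ord0 (lift ord0 ord0)))))).
    by rewrite eh1 eh2 ec !mul0r !addr0.
  by rewrite !E /w; ring.
rewrite sum_ord3; apply: injective_projections.
- by have := key 1 0; rewrite /= sum_ord3 !mul0r !mul1r !addr0.
- by have := key 0 1; rewrite /= sum_ord3 !mul0r !mul1r !add0r.
Qed.

Lemma closed_triangleE {R : realType} {z : 'I_3 -> R * R} {lambda : 'I_3 -> R * R -> R}
    (hz : equilateral z) (hlambda : barycentric z lambda) :
  closed_triangle z = [set p | forall i, 0 <= lambda i p].
Proof.
have [a [b [c E]]] := barycentric_coef hlambda.
apply/seteqP; split => p /=; last first.
  move=> p0; exists (lambda^~ p); split => //.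
    exact: (barycentric_sum hz hlambda).
  exact: (barycentric_expansion hz hlambda).
move=> [t [t0 t1 pE]] i.
suff -> : lambda i p = t i by exact: t0.
transitivity (\sum_j t j * lambda i (z j)); last first.
  under eq_bigr do rewrite (barycentric_vertex hlambda).
  by rewrite (bigD1 i)//= eqxx mulr1 big1 ?addr0// => j;
    rewrite eq_sym => /negbTE ->; rewrite mulr0.
rewrite pE; move: t1; rewrite !sum_ord3 => t1.
(* [lambda i] is affine and not linear: its constant [c i] must be distributed over the points, as
   [c i] times the sum of the weights. *)
by rewrite !E /= -[c i in LHS]mul1r -t1 /GRing.scale /=; ring.
Qed.

Lemma lambda_continuous {R : realType} {z : 'I_3 -> R * R} {lambda : 'I_3 -> R * R -> R}
    (hlambda : barycentric z lambda) i : continuous (lambda i).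
Proof.
have [[a [b [c E]]] _] := hlambda i.
have -> : lambda i = (fun p => a * p.1 + b * p.2 + c) by apply/funext.
move=> p; apply: cvgD; last exact: cvg_cst.
by apply: cvgD; apply: cvgM; (exact: cvg_cst || exact: cvg_fst || exact: cvg_snd).
Qed.

Lemma triangle_domainE {R : realType} {z : 'I_3 -> R * R} {lambda : 'I_3 -> R * R -> R}
    (hz : equilateral z) (hlambda : barycentric z lambda) :
  triangle_domain z = [set p | forall i, 0 < lambda i p].
Proof.
rewrite /triangle_domain (closed_triangleE hz hlambda).
have [a [b [c E]]] := barycentric_coef hlambda.
apply/seteqP; split => p /=; last first.
  move=> p0; suff : nbhs p [set q | forall i, 0 < lambda i q].
    by apply: filterS => q /= q0 i; exact: ltW.
  suff : \forall q \near p, forall i, 0 < lambda i q by [].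
  apply: (@filter_forall _ _ (fun i q => 0 < lambda i q) (nbhs p)) => i.
  exact: (lambda_continuous hlambda i p _ (lt_nbhsr (p0 i))).
move=> ip i; rewrite lt_neqAle; apply/andP; split; last exact: (nbhs_singleton ip).
apply/eqP => pi0.
(* Moving away from z i makes lambda i negative. *)
pose q (t : R) : R * R := p + t *: (p - z i).
have qE t : lambda i (q t) = - t.
  have zi := barycentric_vertex hlambda i i; rewrite eqxx E in zi.
  transitivity (lambda i p + t * (lambda i p - 1)); last by rewrite -pi0; ring.
  by rewrite -[1]zi !E /q /= /GRing.scale /=; ring.
have cq : q t @[t --> (0 : R)] --> p.
  have : q t @[t --> (0 : R)] --> p + (0 : R) *: (p - z i).
    by apply: cvgD; [exact: cvg_cst|exact: cvgZr_tmp].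
  by rewrite scale0r addr0.
have /nbhs_ballP[e /= e0 be] := cq _ ip.
have := be (e / 2); rewrite /ball /= sub0r normrN gtr0_norm ?divr_gt0// ltr_pdivrMr// mulr_natr.
rewrite mulr2n ltrDl => /(_ e0 i); rewrite qE oppr_ge0 leNgt.
by rewrite divr_gt0.
Qed.

Lemma barycentric_gram {R : realType} {z : 'I_3 -> R * R} {lambda : 'I_3 -> R * R -> R}
    (hz : equilateral z) (hlambda : barycentric z lambda) (a b c : 'I_3 -> R) :
  (forall i p, lambda i p = a i * p.1 + b i * p.2 + c i) ->
  exists2 k, 0 < k & forall i j, i != j -> a i * a j + b i * b j = - (k / 2).
Proof.
move=> E; have [s s0 zs] := hz.
exists (4 / (3 * s ^+ 2)); first by rewrite divr_gt0// mulr_gt0// exprn_gt0.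
move=> i j ij; have [k /andP[ki kj]] := ord3_third _ _ ij.
have v l m : a l * (z m).1 + b l * (z m).2 + c l = (l == m)%:R.
  by rewrite -E (barycentric_vertex hlambda).
rewrite (@equilateral_dot _ s (a i) (b i) (c i) (a j) (b j) (c j) (z i) (z j) (z k))//;
  rewrite ?v ?eqxx ?(negbTE ij) 1?eq_sym ?(negbTE ij) ?(negbTE ki) ?(negbTE kj)//.
- by field; rewrite gt_eqF.
- exact: zs.
- by apply: zs; rewrite eq_sym.
- by apply: zs; rewrite eq_sym.
Qed.

Lemma barycentric_coef_sum {R : realType} {z : 'I_3 -> R * R} {lambda : 'I_3 -> R * R -> R}
    (hz : equilateral z) (hlambda : barycentric z lambda) (a b c : 'I_3 -> R) :
  (forall i p, lambda i p = a i * p.1 + b i * p.2 + c i) ->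
  [/\ \sum_i a i = 0, \sum_i b i = 0 & \sum_i c i = 1].
Proof.
move=> E; have S p := barycentric_sum hz hlambda p.
have := S (0, 0); have := S (1, 0); have := S (0, 1).
rewrite !sum_ord3 !E /= => e1 e2 e3; split; lra.
Qed.

(** The third coordinate is [1 - (lambda_0 + lambda_1)], so [(lambda_0, lambda_1)] carries the
    domain onto the unit triangle, with determinant [D]. Lagrange's identity gives
    [D ^+ 2 = k ^+ 2 - (k / 2) ^+ 2], and the area is [1 / (2 |D|)]. *)
Lemma area_triangle_domain {R : realType} {z : 'I_3 -> R * R} {lambda : 'I_3 -> R * R -> R}
    (hz : equilateral z) (hlambda : barycentric z lambda) (a b c : 'I_3 -> R) (k : R) :
  (forall i p, lambda i p = a i * p.1 + b i * p.2 + c i) ->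
  0 < k -> (forall i j, i != j -> a i * a j + b i * b j = - (k / 2)) ->
  area (triangle_domain z) = ((Num.sqrt 3 * k)^-1)%:E.
Proof.
move=> E k0 gram; rewrite (triangle_domainE hz hlambda).
have [sa sb sc] := barycentric_coef_sum hz hlambda _ _ _ E.
move: sa sb sc; rewrite !sum_ord3.
pose i1 : 'I_3 := lift ord0 ord0; pose i2 : 'I_3 := lift ord0 (lift ord0 ord0).
rewrite -/i1 -/i2 => sa sb sc.
have g01 := gram ord0 i1 isT; have g02 := gram ord0 i2 isT; have g12 := gram i1 i2 isT.
pose D := a ord0 * b i1 - a i1 * b ord0.
have DE : D ^+ 2 = 3 / 4 * k ^+ 2.
  (* The gradients add up to 0, so the square of one is minus the sum of its products with the two
     others, [k / 2 + k / 2]. *)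
  have n0 : a ord0 ^+ 2 + b ord0 ^+ 2 = k by nra.
  have n1 : a i1 ^+ 2 + b i1 ^+ 2 = k by nra.
  have -> : D ^+ 2 = (a ord0 ^+ 2 + b ord0 ^+ 2) * (a i1 ^+ 2 + b i1 ^+ 2) -
    (a ord0 * a i1 + b ord0 * b i1) ^+ 2 by rewrite /D; ring.
  by rewrite n0 n1 g01; field.
have absD : `|D| = Num.sqrt 3 * k / 2.
  apply/eqP; rewrite -(@eqrXn2 _ 2)// ?mulr_ge0 ?sqrtr_ge0 ?invr_ge0 ?ltW//.
  by rewrite real_normK ?num_real// DE !exprMn sqr_sqrtr//; apply/eqP; field.
have D0 : D != 0 by rewrite -normr_eq0 absD gt_eqF// divr_gt0// mulr_gt0// sqrtr_gt0.
have := area_affine_triangle _ _ (c ord0) _ _ (c i1) D0.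
rewrite -/D.
rewrite (_ : [set p : R * R | _] = [set p | forall i, 0 < lambda i p]); last first.
  have l2 p : lambda i2 p = 1 - (lambda ord0 p + lambda i1 p).
    by rewrite -(barycentric_sum hz hlambda p) sum_ord3 -/i1 -/i2; ring.
  apply/seteqP; split => p /=; rewrite -!E.
    by move=> [p0 p1 p2]; apply/forall_ord3; split; rewrite -/i1 -/i2 ?l2 ?subr_gt0.
  by move=> p0; split => //; rewrite -subr_gt0 -l2.
move=> H; transitivity ((`|D|^-1)%:E * (2^-1)%:E)%E.
  by rewrite -H muleA -EFinM mulVf ?normr_eq0// mul1e.
by rewrite -EFinM absD; congr EFin; field; rewrite !gt_eqF// sqrtr_gt0.
Qed.

(** * Square-integrable functions *)

Lemma bounded_integrable {R : realType} (O : set (R * R)) (f : R * R -> R) (M : R) :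
  measurable (O : set (plane R)) -> (area O < +oo)%E ->
  measurable_fun (O : set (plane R)) f ->
  (forall p, O p -> `|f p| <= M) -> area.-integrable O (EFin \o f).
Proof.
move=> mO fO mf fM; apply: measurable_bounded_integrable => //.
exists M; split; first exact: num_real.
by move=> x Mx p Op; rewrite /= (le_trans (fM p Op))// ltW.
Qed.

Lemma L2_sqr_integrable {R : realType} {O : set (R * R)} {f : R * R -> R} :
  measurable (O : set (plane R)) -> L2 O f ->
  area.-integrable O (EFin \o (fun p => f p ^+ 2)).
Proof.
move=> mO /Lfun2_integrable_sqr f2; apply/(integrable_mkcond _ mO).
apply: eq_integrable f2 => // p _; rewrite /= !patchE.
by case: ifP => //; rewrite expr0n.
Qed.

Lemma L2M_integrable {R : realType} {O : set (R * R)} {f g : R * R -> R} :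
  measurable (O : set (plane R)) -> L2 O f -> L2 O g ->
  area.-integrable O (EFin \o (fun p => f p * g p)).
Proof.
move=> mO lf lg; have /Lfun1_integrable fg := Lfun2_mul_Lfun1 lf lg.
apply/(integrable_mkcond _ mO).
apply: eq_integrable fg => // p _; rewrite /= !patchE.
by case: ifP => //; rewrite mulr0.
Qed.

Lemma L2B {R : realType} {O : set (R * R)} {f g : R * R -> R} :
  L2 O f -> L2 O g -> L2 O (fun p => f p - g p).
Proof.
rewrite /L2 => lf lg.
have -> : (fun p => f p - g p) \_ O = f \_ O - g \_ O.
  apply/funext => p; rewrite -[RHS]/((f \_ O) p - (g \_ O) p) !patchE.
  by case: ifP => // _; rewrite [RHS]subr0.
have [_ closed2] := Lfun_submod_closed (@area R) (lee1n 2).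
by rewrite addrC -scaleN1r; exact: closed2.
Qed.

Lemma L2_bounded {R : realType} (O : set (R * R)) (f : R * R -> R) (M : R) :
  measurable (O : set (plane R)) -> (area O < +oo)%E ->
  measurable_fun (O : set (plane R)) f ->
  (forall p, O p -> `|f p| <= M) -> L2 O f.
Proof.
move=> mO fO mf fM; rewrite /L2 inE; apply/andP; split.
  by rewrite inE/=; apply/(measurable_restrictT _ mO).
rewrite inE/= /finite_norm unlock poweR_lty//.
have : area.-integrable O (EFin \o (fun p => f p ^+ 2)).
  apply: (bounded_integrable _ _ (M ^+ 2)) => //; first exact: measurable_funX.
  by move=> p Op; rewrite normrX lerXn2r// ?nnegrE// ?fM// (le_trans _ (fM p Op)).
move=> /(integrable_mkcond _ mO) /(integrable_lty measurableT); apply: le_lt_trans.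
rewrite le_eqVlt; apply/orP; left; apply/eqP; apply: eq_integral => p _.
rewrite /= !patchE; case: ifP => _ /=.
  by rewrite powR_mulrn// real_normK// num_real.
by rewrite normr0 powR0.
Qed.

Lemma L2_integrable {R : realType} {O : set (R * R)} {f : R * R -> R} :
  measurable (O : set (plane R)) -> (area O < +oo)%E ->
  L2 O f -> area.-integrable O (EFin \o f).
Proof.
move=> mO fO lf.
have l1 : L2 O (fun=> 1) by apply: (L2_bounded _ _ 1 mO fO) => // p _; rewrite normr1.
have := L2M_integrable mO lf l1.
by apply: eq_integrable => // p _; rewrite /= mulr1.
Qed.

(* If |x| > e then |x| <= x^2 / e, so the bound on the square controls the integral. *)
Lemma integral_small {R : realType} (O : set (R * R)) (f g : R * R -> R) (M e : R) :
  measurable (O : set (plane R)) -> (area O < +oo)%E ->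
  L2 O f -> measurable_fun (O : set (plane R)) g ->
  0 <= M -> (forall p, O p -> `|g p| <= M) ->
  0 < e -> integral_on O (fun p => f p ^+ 2) <= e ^+ 2 ->
  `|integral_on O (fun p => f p * g p)| <= M * e * (fine (area O) + 1).
Proof.
move=> mO fO lf mg M0 gM e0 fe.
have lg : L2 O g by exact: (L2_bounded _ _ _ mO fO mg gM).
have ifg := L2M_integrable mO lf lg.
apply: (le_trans (le_normr_Rintegral mO ifg)).
have i2 := L2_sqr_integrable mO lf.
have i1 : area.-integrable O (EFin \o (fun=> M * e : R)).
  by apply: (bounded_integrable _ _ `|M * e|).
have i3 : area.-integrable O (EFin \o (fun p => (M / e) * f p ^+ 2)).
  have := integrableZl mO (M / e) i2.
  by apply: eq_integrable => // p _; rewrite /= EFinM.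
have i4 : area.-integrable O (EFin \o (fun p => M * e + (M / e) * f p ^+ 2)).
  have := integrableD mO i1 i3.
  by apply: eq_integrable => // p _; rewrite /= EFinD.
(* The integral of this majorant is at most [M * e * area O + (M / e) * e ^+ 2], which is the bound
   claimed. *)
apply: (@le_trans _ _ (integral_on O (fun p => M * e + (M / e) * f p ^+ 2))).
  apply: le_Rintegral => //.
    by apply: (integrable_norm ifg).
  move=> p Op; rewrite normrM mulrC.
  apply: (@le_trans _ _ (M * `|f p|)); first by rewrite ler_wpM2r ?gM.
  rewrite -mulrA -mulrDr ler_wpM2l// -(real_normK (num_real (f p))).
  have [fpe|efp] := leP `|f p| e.
    by rewrite ler_wpDr// mulr_ge0// invr_ge0 ltW.
  by rewrite ler_wpDl ?ltW// ltr_pdivlMl// expr2 ltr_pM2r// (lt_trans e0).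
rewrite /integral_on (RintegralD mO i1 i3) (Rintegral_cst _ mO) (RintegralZl _ mO i2).
rewrite mulrDr mulr1 lerD2l.
rewrite -/(integral_on O _) -mulrA ler_wpM2l// mulrC ler_pdivrMr//.
Qed.

(** * The bubble function *)

Definition grad_coef {R : realType} (a b : 'I_3 -> R) (i : 'I_2) (j : 'I_3) : R :=
  if i == 0 then a j else b j.

Lemma elementary_affine {R : realType} (a b c : R) (l : R * R -> R) :
  (forall p, l p = a * p.1 + b * p.2 + c) -> elementary l.
Proof.
move=> lE.
have -> : l = (((fun=> a) \* fst) \+ ((fun=> b) \* snd)) \+ (fun=> c) by apply/funext.
apply: elementaryD; last exact: elementary_cst.
by apply: elementaryD; apply: elementaryM;
  (exact: elementary_cst || exact: elementary_fst || exact: elementary_snd).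
Qed.

Lemma partial_affine {R : realType} (a b c : R) (l : R * R -> R) i :
  (forall p, l p = a * p.1 + b * p.2 + c) ->
  partial i l = fun=> if i == 0 then a else b.
Proof.
move=> lE.
have ex : elementary ((fun=> a) \* (fst : R * R -> R)).
  by apply: elementaryM; [exact: elementary_cst|exact: elementary_fst].
have ey : elementary ((fun=> b) \* (snd : R * R -> R)).
  by apply: elementaryM; [exact: elementary_cst|exact: elementary_snd].
have ec : elementary (fun=> c : R) by exact: elementary_cst.
have -> : l = (((fun=> a) \* fst) \+ ((fun=> b) \* snd)) \+ (fun=> c) by apply/funext.
have d (f : R * R -> R) : elementary f -> forall p, derivable f p (unit_vector i).
  by move=> ef p; exact: elementary_derivable.
rewrite (partialD _ _ _ (d _ (elementaryD _ _ ex ey)) (d _ ec)).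
rewrite (partialD _ _ _ (d _ ex) (d _ ey)).
rewrite (partialM _ _ _ (d _ (elementary_cst a)) (d _ elementary_fst)).
rewrite (partialM _ _ _ (d _ (elementary_cst b)) (d _ elementary_snd)).
rewrite !partial_cst partial_fst partial_snd; apply/funext => p /=.
by case: (i == 0); rewrite /= ?mulr1 ?mulr0 ?addr0 ?add0r.
Qed.

Lemma prod_ord3 {R : realType} (F : 'I_3 -> R) :
  \prod_(i < 3) F i = F ord0 * F (lift ord0 ord0) * F (lift ord0 (lift ord0 ord0)).
Proof. by rewrite !big_ord_recl big_ord0 mulr1 mulrA. Qed.

Lemma elementary_prod3 {R : realType} (f : 'I_3 -> R * R -> R) :
  (forall j, elementary (f j)) -> elementary (fun p => \prod_(j < 3) f j p).
Proof.
move=> ef.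
have -> : (fun p => \prod_(j < 3) f j p) =
    (f ord0 \* f (lift ord0 ord0)) \* f (lift ord0 (lift ord0 ord0)).
  by apply/funext => p; rewrite prod_ord3.
by apply: elementaryM => //; exact: elementaryM.
Qed.

Lemma partial_prod3 {R : realType} (f : 'I_3 -> R * R -> R) i :
  (forall j, elementary (f j)) ->
  partial i (fun p => \prod_(j < 3) f j p) =
  fun p => partial i (f ord0) p * f (lift ord0 ord0) p * f (lift ord0 (lift ord0 ord0)) p
    + partial i (f (lift ord0 ord0)) p * f ord0 p * f (lift ord0 (lift ord0 ord0)) p
    + partial i (f (lift ord0 (lift ord0 ord0))) p * f ord0 p * f (lift ord0 ord0) p.
Proof.
move=> ef.
have -> : (fun p => \prod_(j < 3) f j p) =
    (f ord0 \* f (lift ord0 ord0)) \* f (lift ord0 (lift ord0 ord0)).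
  by apply/funext => p; rewrite prod_ord3.
have d (g : R * R -> R) : elementary g -> forall p, derivable g p (unit_vector i).
  by move=> eg p; exact: elementary_derivable.
rewrite (partialM _ _ _ (d _ (elementaryM _ _ (ef _) (ef _))) (d _ (ef _))).
rewrite (partialM _ _ _ (d _ (ef _)) (d _ (ef _))).
by apply/funext => p /=; ring.
Qed.

(* For t > a this is (t - a) e^(-x) with x = a / (t - a), whose derivative is
   (1 + x) e^(-x) <= 1: the bound is uniform in a, and as a tends to 0 the function
   and its derivative tend to t and 1, which is what dominated convergence needs. *)
Definition cutoff {R : realType} (a t : R) : R := (t - a) * bump a 1 (t - a).

Definition cutoff_deriv {R : realType} (a t : R) : R :=
  bump a 1 (t - a) + (t - a) * bump a (bump_deriv_poly a 1) (t - a).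

Lemma cutoffE {R : realType} (a t : R) : a < t ->
  cutoff a t = (t - a) * expR (- (a / (t - a))) /\
  cutoff_deriv a t = (1 + a / (t - a)) * expR (- (a / (t - a))).
Proof.
move=> at0; have s0 : 0 < t - a by rewrite subr_gt0.
have sn0 : t - a != 0 by rewrite gt_eqF.
have d1 : (1 : {poly R})^`() = 0 by rewrite -polyC1 derivC.
rewrite /cutoff /cutoff_deriv /bump s0 /bump_deriv_poly d1 subr0.
by rewrite !hornerE /=; split => //; field.
Qed.

Lemma cutoff_le {R : realType} (a t : R) : t <= a -> cutoff a t = 0 /\ cutoff_deriv a t = 0.
Proof.
move=> ta; have s0 : (0 < t - a) = false by rewrite subr_gt0 ltNge ta.
by rewrite /cutoff /cutoff_deriv /bump s0 mulr0 addr0.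
Qed.

Lemma cutoff_bound {R : realType} (a t : R) : 0 < a -> t <= 1 ->
  `|cutoff a t| <= 1 /\ `|cutoff_deriv a t| <= 1.
Proof.
move=> a0 t1; have [ta|at0] := leP t a.
  by have [-> ->] := cutoff_le _ _ ta; rewrite normr0.
have [-> ->] := cutoffE _ _ at0.
have s0 : 0 < t - a by rewrite subr_gt0.
have q0 : 0 <= a / (t - a) by rewrite divr_ge0// ltW.
have e0 := expR_ge0 (- (a / (t - a))).
have s0' := ltW s0.
rewrite !ger0_norm ?mulr_ge0// ?addr_ge0//; split.
  rewrite -[leRHS]mulr1 ler_pM// ?expR_le1 ?oppr_le0//.
  by rewrite lerBlDr (le_trans t1)// lerDl ltW.
by rewrite expRN ler_pdivrMr ?expR_gt0// mul1r expR_ge1Dx.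
Qed.

Lemma cutoff_cvg {R : realType} (t : R) : 0 < t ->
  cutoff n.+1%:R^-1 t @[n --> \oo] --> t /\ cutoff_deriv n.+1%:R^-1 t @[n --> \oo] --> (1 : R).
Proof.
move=> t0.
have ca : (n.+1%:R^-1 : R) @[n --> \oo] --> (0 : R) by exact: cvg_harmonic.
have cs : (t - n.+1%:R^-1 : R) @[n --> \oo] --> t.
  by rewrite -[X in _ --> X]subr0; apply: cvgB => //; exact: cvg_cst.
have cq : (n.+1%:R^-1 / (t - n.+1%:R^-1) : R) @[n --> \oo] --> (0 : R).
  rewrite -[X in _ --> X](mul0r t^-1); apply: cvgM => //.
  by apply: cvgV => //; rewrite gt_eqF.
have ce : expR (- (n.+1%:R^-1 / (t - n.+1%:R^-1)) : R) @[n --> \oo] --> (1 : R).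
  rewrite -[X in _ --> X]expR0 -oppr0.
  by apply: continuous_cvg; [exact: continuous_expR|exact: cvgN].
(* The closed forms of [cutoffE] hold only beyond the threshold, hence from some [n] on. *)
have ev : \forall n \near \oo, (n.+1%:R^-1 : R) < t.
  by apply: (cvgr_lt (0 : R)).
split.
- have : (t - n.+1%:R^-1) * expR (- (n.+1%:R^-1 / (t - n.+1%:R^-1)) : R) @[n --> \oo] --> t.
    by rewrite -[X in _ --> X]mulr1; exact: cvgM.
  apply: cvg_trans; apply: near_eq_cvg.
  by near=> n; rewrite (cutoffE _ _ _).1//; near: n.
- have : (1 + n.+1%:R^-1 / (t - n.+1%:R^-1)) *
      expR (- (n.+1%:R^-1 / (t - n.+1%:R^-1)) : R) @[n --> \oo] --> (1 + 0) * (1 : R).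
    by apply: cvgM => //; apply: cvgD => //; exact: cvg_cst.
  rewrite addr0 mulr1.
  apply: cvg_trans; apply: near_eq_cvg.
  by near=> n; rewrite (cutoffE _ _ _).2//; near: n.
Unshelve. all: end_near.
Qed.

(** The set is an intersection of closed half-planes, and it is bounded because its points combine
    the vertices with weights at most 1. *)
Lemma closed_triangle_compact {R : realType} {z : 'I_3 -> R * R} {lambda : 'I_3 -> R * R -> R}
    (hz : equilateral z) (hlambda : barycentric z lambda) : compact (closed_triangle z).
Proof.
have lp p i : (forall j, 0 <= lambda j p) -> lambda i p <= 1.
  move=> p0; rewrite -(barycentric_sum hz hlambda p) (bigD1 i)//= lerDl.
  by rewrite sumr_ge0.
pose M := \sum_i `|z i|.
apply: (@subclosed_compact _ _ (`[- M, M]%classic `*` `[- M, M]%classic)).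
- rewrite (closed_triangleE hz hlambda).
  have -> : [set p | forall i, 0 <= lambda i p] =
      \bigcap_(i in setT) (lambda i @^-1` [set t | 0 <= t]).
    by apply/seteqP; split => p /= p0 i; have := p0 i; [|apply].
  apply: closed_bigI => i _; apply: closed_comp; last exact: closed_ge.
  by move=> p _; exact: lambda_continuous.
- by apply: compact_setX; exact: segment_compact.
- move=> p pT; have : `|p| <= M.
    move: pT; rewrite (closed_triangleE hz hlambda) => /= p0.
    rewrite (barycentric_expansion hz hlambda p) (le_trans (ler_norm_sum _ _ _))//.
    apply: ler_sum => i _; rewrite normrZ ger0_norm// ler_piMl//; exact: lp.
  by rewrite prod_normE ge_max !ler_norml /= !in_itv /= => /andP[-> ->].
Qed.

Lemma triangle_domain_sub {R : realType} (z : 'I_3 -> R * R) :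
  triangle_domain z `<=` closed_triangle z.
Proof. exact: interior_subset. Qed.

Lemma measurable_triangle_domain {R : realType} (z : 'I_3 -> R * R) :
  measurable (triangle_domain z : set (plane R)).
Proof. by apply: open_measurable_plane; exact: open_interior. Qed.

Lemma continuous_bounded {R : realType} (K : set (R * R)) (f : R * R -> R) :
  compact K -> continuous f -> exists2 M, 0 <= M & forall p, K p -> `|f p| <= M.
Proof.
move=> cK cf; have cfK : compact (f @` K).
  by apply: continuous_compact => //; exact: continuous_subspaceT.
have [N [Nr fN]] := compact_bounded cfK.
exists (`|N| + 1) => [|p Kp]; first by rewrite addr_ge0.
by apply: (fN (`|N| + 1)); [rewrite (le_lt_trans (ler_norm N))// ltrDl|exists p].
Qed.

Lemma continuous_L2 {R : realType} (O K : set (R * R)) (f : R * R -> R) :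
  measurable (O : set (plane R)) -> (area O < +oo)%E ->
  compact K -> O `<=` K -> continuous f -> L2 O f.
Proof.
move=> mO fO cK OK cf; have [M _ fM] := continuous_bounded _ _ cK cf.
apply: (L2_bounded _ _ M) => //; last by move=> p /OK; exact: fM.
by apply: measurable_funTS; exact: continuous_measurable_plane.
Qed.

(** Dominated convergence with the constant majorant [M ^+ 2], which is integrable because the area
    is finite. *)
Lemma integral_sqr_cvg0 {R : realType} (O : set (R * R)) (f : nat -> R * R -> R) (M : R) :
  measurable (O : set (plane R)) -> (area O < +oo)%E ->
  (forall n, measurable_fun (O : set (plane R)) (f n)) ->
  (forall n p, O p -> `|f n p| <= M) -> (forall p, O p -> f n p @[n --> \oo] --> (0 : R)) ->
  integral_on O (fun p => f n p ^+ 2) @[n --> \oo] --> (0 : R).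
Proof.
move=> mO fO mf fM f0.
have iM : area.-integrable O (EFin \o (fun=> M ^+ 2 : R)).
  by apply: (bounded_integrable _ _ `|M ^+ 2|).
have [] := @dominated_convergence _ _ _ (@area R) O mO
  (fun n => EFin \o (fun p => f n p ^+ 2)) (EFin \o (fun=> 0)) (EFin \o (fun=> M ^+ 2)).
- by move=> n; apply/measurable_EFinP; exact: measurable_funX.
- exact: measurable_cst.
- apply: aeW => p Op; apply: cvg_EFin; first by near=> n.
  rewrite (_ : _ \o _ = (fun n => f n p ^+ 2))//.
  have := cvgM (f0 p Op) (f0 p Op); rewrite mulr0; apply.
- exact: iM.
- apply: aeW => p n Op; rewrite /= lee_fin normrX lerXn2r// ?nnegrE// ?fM//.
  by rewrite (le_trans _ (fM n p Op)).
move=> _ _; rewrite (_ : (\int[_]_(_ in _) _)%E = 0%:E); last exact: integral0.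
by move/fine_cvg.
Unshelve. all: end_near.
Qed.

Lemma elementary_cutoff {R : realType} (a : R) (l : R * R -> R) : 0 < a -> elementary l ->
  elementary (fun p => cutoff a (l p)).
Proof.
move=> a0 el.
have es : elementary (l \+ fun=> - a) by apply: elementaryD => //; exact: elementary_cst.
exact: (elementaryM _ _ es (elementary_bump a 1 _ a0 es)).
Qed.

Lemma partial_cutoff {R : realType} (a : R) (l : R * R -> R) i : 0 < a -> elementary l ->
  partial i (fun p => cutoff a (l p)) = fun p => partial i l p * cutoff_deriv a (l p).
Proof.
move=> a0 el; pose s := l \+ fun=> - a.
have es : elementary s by apply: elementaryD => //; exact: elementary_cst.
have eb : elementary (bump a 1 \o s) by exact: elementary_bump.
have d (g : R * R -> R) : elementary g -> forall p, derivable g p (unit_vector i).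
  by move=> eg p; exact: elementary_derivable.
have -> : (fun p => cutoff a (l p)) = s \* (bump a 1 \o s) by [].
rewrite (partialM _ _ _ (d _ es) (d _ eb)).
rewrite (partial_bump _ _ _ _ a0 (fun p => elementary_differentiable _ p es)).
rewrite /s (partialD _ _ _ (d _ el) (d _ (elementary_cst _))) partial_cst.
by apply/funext => p /=; rewrite addr0 /cutoff_deriv; ring.
Qed.

Lemma elementary_lambda {R : realType} {z : 'I_3 -> R * R} {lambda : 'I_3 -> R * R -> R}
    (hlambda : barycentric z lambda) j : elementary (lambda j).
Proof. by have [[a [b [c E]]] _] := hlambda j; exact: elementary_affine E. Qed.

Lemma elementary_bubble {R : realType} {z : 'I_3 -> R * R} {lambda : 'I_3 -> R * R -> R}
    (hlambda : barycentric z lambda) : elementary (bubble lambda).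
Proof. by apply: elementary_prod3 => j; exact: (elementary_lambda hlambda). Qed.

Lemma partial_scaleM {R : realType} i (c : R) (f g : R * R -> R) :
  elementary f -> elementary g ->
  partial i (fun p => c * f p * g p) =
  fun p => c * (partial i f p * g p + f p * partial i g p).
Proof.
move=> ef eg; have ec : elementary (fun=> c : R) by exact: elementary_cst.
have d (h : R * R -> R) : elementary h -> forall p, derivable h p (unit_vector i).
  by move=> eh p; exact: elementary_derivable.
rewrite -[X in partial i X]/(((fun=> c) \* f) \* g).
rewrite (partialM _ _ _ (d _ (elementaryM _ _ ec ef)) (d _ eg)).
rewrite (partialM _ _ _ (d _ ec) (d _ ef)) partial_cst.
by apply/funext => p /=; ring.
Qed.

Lemma laplacian_bubble {R : realType} {z : 'I_3 -> R * R} {lambda : 'I_3 -> R * R -> R}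
    (hz : equilateral z) (hlambda : barycentric z lambda) (a b c : 'I_3 -> R) (k : R) :
  (forall i p, lambda i p = a i * p.1 + b i * p.2 + c i) ->
  (forall i j, i != j -> a i * a j + b i * b j = - (k / 2)) ->
  forall p, \sum_(i < 2) partial i (partial i (bubble lambda)) p = - k.
Proof.
move=> E gram p.
pose i1 : 'I_3 := lift ord0 ord0; pose i2 : 'I_3 := lift ord0 (lift ord0 ord0).
have el j : elementary (lambda j) by exact: (elementary_lambda hlambda).
have dl i j : partial i (lambda j) = fun=> grad_coef a b i j.
  exact: (partial_affine _ _ _ _ _ (E j)).
(* The factors are affine, so only terms that differentiate two distinct factors survive; each pair
   occurs in two orders, whence the 2. *)
have dd i : partial i (partial i (bubble lambda)) p =
  2 * (grad_coef a b i ord0 * grad_coef a b i i1 * lambda i2 p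
  + grad_coef a b i ord0 * grad_coef a b i i2 * lambda i1 p
  + grad_coef a b i i1 * grad_coef a b i i2 * lambda ord0 p).
  rewrite /bubble (partial_prod3 _ _ el) !dl -/i1 -/i2.
  pose m d j j' p := d * lambda j p * lambda j' p.
  have em d j j' : elementary (m d j j').
    by apply: (elementaryM _ _ (elementaryM _ _ (elementary_cst d) (el j)) (el j')).
  have dm (h : R * R -> R) : elementary h -> forall p, derivable h p (unit_vector i).
    by move=> eh q; exact: elementary_derivable.
  rewrite -[X in partial i X]/((m (grad_coef a b i ord0) _ _ \+ m _ ord0 _) \+ m _ _ _).
  rewrite (partialD _ _ _ (dm _ (elementaryD _ _ (em _ _ _) (em _ _ _))) (dm _ (em _ _ _))).
  rewrite (partialD _ _ _ (dm _ (em _ _ _)) (dm _ (em _ _ _))) /m /=.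
  by rewrite !partial_scaleM// !dl; ring.
rewrite (eq_bigr _ (fun i _ => dd i)) !big_ord_recl big_ord0 addr0 /grad_coef /=.
have g01 := gram ord0 i1 isT.
have g02 := gram ord0 i2 isT.
have g12 := gram i1 i2 isT.
have s1 := barycentric_sum hz hlambda p; rewrite sum_ord3 -/i1 -/i2 in s1.
transitivity (2 * ((a ord0 * a i1 + b ord0 * b i1) * lambda i2 p
  + (a ord0 * a i2 + b ord0 * b i2) * lambda i1 p
  + (a i1 * a i2 + b i1 * b i2) * lambda ord0 p)).
  by ring.
rewrite g01 g02 g12 -[RHS]mulr1 -[in RHS]s1.
by field.
Qed.

(** The product is nonzero only in the smaller triangle [K], which is closed and hence contains the
    support. As [a > 0], [K] lies inside the open triangle, and it is compact as a closed part of
    the closed one. *)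
Lemma test_function_cutoff {R : realType} {z : 'I_3 -> R * R} {lambda : 'I_3 -> R * R -> R}
    (hz : equilateral z) (hlambda : barycentric z lambda) (a : R) : 0 < a ->
  test_function (triangle_domain z) (fun p => \prod_(j < 3) cutoff a (lambda j p)).
Proof.
move=> a0; pose K := [set p | forall j, a <= lambda j p].
have cK : closed K.
  have -> : K = \bigcap_(i in setT) (lambda i @^-1` [set t | a <= t]).
    by apply/seteqP; split => p /= p0 i; have := p0 i; [|apply].
  apply: closed_bigI => i _; apply: closed_comp; last exact: closed_ge.
  by move=> p _; exact: lambda_continuous.
have suppK : Defs.support (fun p => \prod_(j < 3) cutoff a (lambda j p)) `<=` K.
  rewrite /Defs.support [X in _ `<=` X](closure_id _).1//.
  apply: closure_subset => p /= /prodf_neq0 p0 j; rewrite leNgt; apply/negP => lja.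
  by have := p0 j isT; rewrite (cutoff_le _ _ (ltW lja)).1 eqxx.
split.
- apply: elementary_smooth; apply: elementary_prod3 => j.
  by apply: elementary_cutoff => //; exact: (elementary_lambda hlambda).
- apply: (subclosed_compact _ (closed_triangle_compact hz hlambda)).
    exact: closed_closure.
  apply: (subset_trans suppK) => p pK; rewrite (closed_triangleE hz hlambda) => j.
  by rewrite (le_trans _ (pK j))// ltW.
- apply: (subset_trans suppK) => p pK; rewrite (triangle_domainE hz hlambda) => j.
  exact: lt_le_trans (pK j).
Qed.

Lemma sum_ord2 {V : nmodType} (F : 'I_2 -> V) :
  \sum_(i < 2) F i = F ord0 + F (lift ord0 ord0).
Proof. by rewrite !big_ord_recl big_ord0 addr0. Qed.

Lemma norm_prod3_le1 {R : realType} (x y w : R) :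
  `|x| <= 1 -> `|y| <= 1 -> `|w| <= 1 -> `|x * y * w| <= 1.
Proof.
by move=> x1 y1 w1; rewrite !normrM mulr_ile1 ?mulr_ge0// mulr_ile1.
Qed.

Lemma norm_sum3_le {R : realType} (d0 d1 d2 x0 x1 x2 y0 y1 y2 w0 w1 w2 : R) :
  `|x0| <= 1 -> `|x1| <= 1 -> `|x2| <= 1 ->
  `|y0| <= 1 -> `|y1| <= 1 -> `|y2| <= 1 ->
  `|w0| <= 1 -> `|w1| <= 1 -> `|w2| <= 1 ->
  `|d0 * x0 * y0 * w0 + d1 * x1 * y1 * w1 + d2 * x2 * y2 * w2| <= `|d0| + `|d1| + `|d2|.
Proof.
move=> ? ? ? ? ? ? ? ? ?.
have H (d x y w : R) : `|x| <= 1 -> `|y| <= 1 -> `|w| <= 1 -> `|d * x * y * w| <= `|d|.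
  move=> ? ? ?; rewrite -!mulrA mulrA -[d * _ * _]mulrA normrM ler_piMr// mulrA.
  exact: norm_prod3_le1.
by rewrite (le_trans (ler_normD _ _))// lerD ?H// (le_trans (ler_normD _ _))// lerD ?H.
Qed.

Lemma H10_bubble {R : realType} {z : 'I_3 -> R * R} {lambda : 'I_3 -> R * R -> R}
    (hz : equilateral z) (hlambda : barycentric z lambda) :
  (area (triangle_domain z) < +oo)%E ->
  H10 (triangle_domain z) (bubble lambda) (fun i => partial i (bubble lambda)).
Proof.
set O := triangle_domain z; set B := bubble lambda => fO.
have mO : measurable (O : set (plane R)).
  exact: measurable_triangle_domain.
have eB : elementary B := elementary_bubble hlambda.
have sB := elementary_smooth _ eB.
have cK := closed_triangle_compact hz hlambda.
have OK := @triangle_domain_sub _ z.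
split.
  split.
  - by apply: (continuous_L2 _ _ _ mO fO cK OK); exact: smooth_continuous.
  - by move=> i; apply: (continuous_L2 _ _ _ mO fO cK OK); exact: smooth_continuous_partial.
  - by move=> phi tphi i; exact: integral_on_by_parts.
move=> e e0.
pose a (n : nat) : R := n.+1%:R^-1.
have a0 n : 0 < a n by rewrite invr_gt0.
pose phi n p := \prod_(j < 3) cutoff (a n) (lambda j p).
have tphi n : test_function O (phi n) by exact: test_function_cutoff.
have el j : elementary (lambda j) by exact: (elementary_lambda hlambda).
have ec n j : elementary (fun p => cutoff (a n) (lambda j p)).
  exact: elementary_cutoff.
have lO p : O p -> forall j, 0 < lambda j p <= 1.
  rewrite /O (triangle_domainE hz hlambda) => Op j; rewrite Op/=.
  rewrite -(barycentric_sum hz hlambda p) (bigD1 j)//= lerDl sumr_ge0// => ? _.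
  by rewrite ltW.
have l1 p : O p -> forall j, `|lambda j p| <= 1.
  by move=> Op j; have /andP[l0 l1] := lO p Op j; rewrite gtr0_norm.
have c1 p n : O p -> forall j, `|cutoff (a n) (lambda j p)| <= 1.
  by move=> Op j; have /andP[_ l1'] := lO p Op j; exact: (cutoff_bound _ _ (a0 n) l1').1.
have d1 p n : O p -> forall j, `|cutoff_deriv (a n) (lambda j p)| <= 1.
  by move=> Op j; have /andP[_ l1'] := lO p Op j; exact: (cutoff_bound _ _ (a0 n) l1').2.
(* Positivity of [lambda j p] in the open triangle is essential here: at [t = 0] every
   [cutoff_deriv] is 0 and does not approach 1. *)
have cc p : O p -> forall j, cutoff (a n) (lambda j p) @[n --> \oo] --> lambda j p.
  by move=> Op j; have /andP[l0 _] := lO p Op j; exact: (cutoff_cvg _ l0).1.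
have cd p : O p -> forall j, cutoff_deriv (a n) (lambda j p) @[n --> \oo] --> (1 : R).
  by move=> Op j; have /andP[l0 _] := lO p Op j; exact: (cutoff_cvg _ l0).2.
have mfun (f g : R * R -> R) : continuous f -> continuous g ->
    measurable_fun (O : set (plane R)) (fun p => f p - g p).
  move=> cf cg; apply: measurable_funTS; apply: continuous_measurable_plane => p.
  by apply: cvgB; [exact: cf|exact: cg].
have I0 : integral_on O (fun p => (B p - phi n p) ^+ 2) @[n --> \oo] --> (0 : R).
  apply: (integral_sqr_cvg0 _ (fun n p => B p - phi n p) 2 mO fO).
  - move=> n; apply: mfun; first exact: smooth_continuous.
    by apply: smooth_continuous; have [] := tphi n.
  - move=> n p Op; rewrite (le_trans (ler_normB _ _))// -[leRHS]/(1 + 1) /B /bubble /phi.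
    by rewrite !prod_ord3 lerD//; apply: norm_prod3_le1; (exact: l1 || exact: c1).
  - move=> p Op; rewrite -(subrr (B p)); apply: cvgB; first exact: cvg_cst.
    rewrite /B /bubble /phi prod_ord3; under eq_fun do rewrite prod_ord3.
    by apply: cvgM; [apply: cvgM|]; exact: cc.
have I1 i : integral_on O (fun p => (partial i B p - partial i (phi n) p) ^+ 2)
    @[n --> \oo] --> (0 : R).
  pose dl j := partial i (lambda j).
  have dlE j : exists d, dl j = fun=> d.
    have [[u [v [w E]]] _] := hlambda j.
    by eexists; exact: (partial_affine _ _ _ _ _ E).
  have [d dE] := choice dlE.
  pose i1 : 'I_3 := lift ord0 ord0; pose i2 : 'I_3 := lift ord0 (lift ord0 ord0).
  (* The factors 1 stand where [partial i (phi n)] has a [cutoff_deriv]: the two derivatives then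
     match term by term, for the bound of [norm_sum3_le] as well as for the limit. *)
  have dB p : partial i B p = d ord0 * 1 * lambda i1 p * lambda i2 p
      + d i1 * 1 * lambda ord0 p * lambda i2 p
      + d i2 * 1 * lambda ord0 p * lambda i1 p.
    by rewrite /B /bubble (partial_prod3 _ _ el) -![partial i (lambda _)]/(dl _) !dE !mulr1.
  have dphi n p : partial i (phi n) p =
      d ord0 * cutoff_deriv (a n) (lambda ord0 p) * cutoff (a n) (lambda i1 p)
        * cutoff (a n) (lambda i2 p)
      + d i1 * cutoff_deriv (a n) (lambda i1 p) * cutoff (a n) (lambda ord0 p)
        * cutoff (a n) (lambda i2 p)
      + d i2 * cutoff_deriv (a n) (lambda i2 p)
        * cutoff (a n) (lambda ord0 p) * cutoff (a n) (lambda i1 p).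
    rewrite /phi (partial_prod3 _ _ (ec n)) !(partial_cutoff _ _ _ (a0 n) (el _)).
    by rewrite -![partial i (lambda _)]/(dl _) !dE.
  pose C := `|d ord0| + `|d i1| + `|d i2|.
  apply: (integral_sqr_cvg0 _ (fun n p => partial i B p - partial i (phi n) p) (C + C) mO fO).
  - move=> n; apply: mfun; first exact: smooth_continuous_partial.
    by apply: smooth_continuous_partial; have [] := tphi n.
  - move=> n p Op; rewrite (le_trans (ler_normB _ _))// dB dphi.
    by rewrite lerD//; apply: norm_sum3_le; rewrite ?normr1//;
      (exact: l1 || exact: c1 || exact: d1).
  - move=> p Op; rewrite -(subrr (partial i B p)); apply: cvgB; first exact: cvg_cst.
    rewrite dB; under eq_fun do rewrite dphi.
    have term (t : R) j j' j'' : t * cutoff_deriv (a n) (lambda j p) * cutoff (a n) (lambda j' p)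
        * cutoff (a n) (lambda j'' p) @[n --> \oo] --> t * 1 * lambda j' p * lambda j'' p.
      apply: cvgM; last exact: cc.
      apply: cvgM; last exact: cc.
      by apply: cvgM; [exact: cvg_cst|exact: cd].
    by apply: cvgD; [apply: cvgD|]; exact: term.
pose S n := integral_on O (fun p => (B p - phi n p) ^+ 2) +
  \sum_(i < 2) integral_on O (fun p => (partial i B p - partial i (phi n) p) ^+ 2).
have S0 : S n @[n --> \oo] --> (0 : R).
  have := cvgD I0 (cvgD (I1 ord0) (I1 (lift ord0 ord0))); rewrite !addr0 => cS.
  have SE : S = fun n => integral_on O (fun p => (B p - phi n p) ^+ 2) +
    (integral_on O (fun p => (partial ord0 B p - partial ord0 (phi n) p) ^+ 2) +
     integral_on O (fun p =>
       (partial (lift ord0 ord0) B p - partial (lift ord0 ord0) (phi n) p) ^+ 2)).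
    by apply/funext => n; congr (_ + _); exact: sum_ord2.
  by rewrite SE; exact: cS.
have [N _ HN] : \forall n \near \oo, S n < e ^+ 2.
  by apply: (cvgr_lt (0 : R)) => //; rewrite exprn_gt0.
exists (phi N); first exact: tphi.
rewrite /H1dist /H1norm -/(S N) -[ltRHS](ger0_norm (ltW e0)) -sqrtr_sqr.
by rewrite ltr_sqrt ?exprn_gt0//; apply: HN => /=.
Qed.

(** * The mean of the solution *)

(** [weak_gradient] only allows test functions in the place of [g], whereas this [g] may be nonzero
    on the boundary. For a test function in the place of [u] the identity is the classical one; both
    sides depend continuously on [u] in the H^1 norm, as [g] and its derivatives are bounded on
    [K]. *)
Lemma H10_by_parts {R : realType} (O K : set (R * R)) (u g : R * R -> R)
    (Du : 'I_2 -> R * R -> R) i :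
  measurable (O : set (plane R)) -> (area O < +oo)%E ->
  compact K -> O `<=` K -> H10 O u Du -> smooth g ->
  integral_on O (fun p => Du i p * g p) = - integral_on O (fun p => u p * partial i g p).
Proof.
move=> mO fO cK OK [[l2u l2Du _] dense] sg.
have cg := smooth_continuous _ sg.
have cg' := smooth_continuous_partial i _ sg.
have [M M0 gM] := continuous_bounded _ _ cK cg.
have [M' M'0 gM'] := continuous_bounded _ _ cK cg'.
have l2g := continuous_L2 _ _ _ mO fO cK OK cg.
have l2g' := continuous_L2 _ _ _ mO fO cK OK cg'.
have mc (f : R * R -> R) : continuous f ->
    measurable_fun (O : set (plane R)) f.
  by move=> cf; apply: measurable_funTS; exact: continuous_measurable_plane.
apply/eqP; rewrite -addr_eq0 -normr_le0; apply/ler_addgt0Pl => e e0; rewrite addr0.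
(* [A * d] is the sum of the two errors given by [integral_small] for an approximation within [d];
   dividing by [A + 1] keeps [d] defined when [A = 0]. *)
pose A := (M + M') * (fine (area O) + 1).
have A0 : 0 <= A by rewrite mulr_ge0 ?addr_ge0// fine_ge0.
pose d := e / (A + 1).
have d0 : 0 < d by rewrite divr_gt0// ltr_wpDl.
have [phi tphi] := dense d d0.
rewrite /H1dist /H1norm => Hd.
have sphi : smooth phi by have [] := tphi.
have l2phi := continuous_L2 _ _ _ mO fO cK OK (smooth_continuous _ sphi).
have l2phi' j := continuous_L2 _ _ _ mO fO cK OK (smooth_continuous_partial j _ sphi).
have sq0 (f : R * R -> R) : 0 <= integral_on O (fun p => f p ^+ 2).
  by apply: Rintegral_ge0 => p _; exact: sqr_ge0.
have {Hd} Hd : integral_on O (fun p => (u p - phi p) ^+ 2) +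
    \sum_(j < 2) integral_on O (fun p => (Du j p - partial j phi p) ^+ 2) <= d ^+ 2.
  rewrite -[leLHS]sqr_sqrtr; last by rewrite addr_ge0 ?sumr_ge0// => j _; exact: sq0.
  by rewrite ler_pXn2r// ?nnegrE ?sqrtr_ge0// ltW.
have Hu : integral_on O (fun p => (u p - phi p) ^+ 2) <= d ^+ 2.
  by apply: le_trans Hd; rewrite lerDl sumr_ge0// => j _; exact: sq0.
have HDu : integral_on O (fun p => (Du i p - partial i phi p) ^+ 2) <= d ^+ 2.
  apply: le_trans Hd; apply: ler_wpDl; first exact: sq0.
  by rewrite (bigD1 i)//= lerDl sumr_ge0// => j _; exact: sq0.
have split_int (f h w : R * R -> R) : L2 O f -> L2 O h -> L2 O w ->
    integral_on O (fun p => f p * w p) =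
    integral_on O (fun p => (f p - h p) * w p) + integral_on O (fun p => h p * w p).
  move=> lf lh lw; rewrite /integral_on
    -(RintegralD mO (L2M_integrable mO (L2B lf lh) lw) (L2M_integrable mO lh lw)).
  by apply: eq_Rintegral => p _; rewrite mulrBl subrK.
rewrite (split_int _ (partial i phi) _ (l2Du i) (l2phi' i) l2g).
rewrite (split_int _ phi _ l2u l2phi l2g').
have ibp := integral_on_by_parts _ _ _ i tphi sg.
have ibp' : integral_on O (fun p => partial i phi p * g p) =
    - integral_on O (fun p => phi p * partial i g p).
  transitivity (integral_on O (fun p => g p * partial i phi p)).
    by congr (integral_on O _); apply/funext => p; rewrite mulrC.
  by rewrite ibp; congr (- integral_on O _); apply/funext => p; rewrite mulrC.
(* The integrals that involve [phi] alone cancel; the errors from [Du i - partial i phi] and from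
   [u - phi] remain. *)
rewrite ibp' addrACA [- _ + _]addrC subrr addr0 (le_trans (ler_normD _ _))//.
have B1 := integral_small _ _ _ M d mO fO (L2B (l2Du i) (l2phi' i)) (mc _ cg) M0
  (fun p Op => gM p (OK p Op)) d0 HDu.
have B2 := integral_small _ _ _ M' d mO fO (L2B l2u l2phi) (mc _ cg') M'0
  (fun p Op => gM' p (OK p Op)) d0 Hu.
rewrite (le_trans (lerD B1 B2))// -mulrDl -mulrDl mulrAC -/A /d.
rewrite mulrC mulrAC ler_pdivrMr; last by rewrite ltr_wpDl.
by rewrite ler_pM2l// lerDl.
Qed.

Theorem theorem4p3 (R : realType) (z : 'I_3 -> R * R) (hz : equilateral z)
    (lambda : 'I_3 -> R * R -> R) (hlambda : barycentric z lambda) :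
  let Omega := triangle_domain z in
  let B := bubble lambda in
  (forall f u : R * R -> R,
     L2 Omega f ->
     weak_solution Omega (fun v => integral_on Omega (fun p => f p * v p)) u ->
     integral_on Omega u =
       Num.sqrt 3 * fine (area Omega)
         * integral_on Omega (fun p => f p * B p)) /\
  (forall (F : (R * R -> R) -> R) (u : R * R -> R),
     continuous_functional_H10 Omega F ->
     weak_solution Omega F u ->
     integral_on Omega u = Num.sqrt 3 * fine (area Omega) * F B).
Proof.
move=> Omega B.
(* Both halves are instances of one statement on [weak_solution], with [F] the pairing with [f] in
   the first. *)
suff main (F : (R * R -> R) -> R) u : weak_solution Omega F u ->
    integral_on Omega u = Num.sqrt 3 * fine (area Omega) * F B.
  by split=> [f u _|F u _]; exact: main.
move=> [Du hu Fu].
have [a [b [c E]]] := barycentric_coef hlambda.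
have [k k0 gram] := barycentric_gram hz hlambda _ _ _ E.
have aO := area_triangle_domain hz hlambda _ _ _ _ E k0 gram.
have fO : (area Omega < +oo)%E by rewrite aO ltry.
have mO : measurable (Omega : set (plane R)).
  exact: measurable_triangle_domain.
have cK := closed_triangle_compact hz hlambda.
have OK : Omega `<=` closed_triangle z by exact: triangle_domain_sub.
have [l2u l2Du _] := hu.1.
have eB : elementary B := elementary_bubble hlambda.
have eB' i : elementary (partial i B) by exact: elementary_partial.
have L2e (f : R * R -> R) : elementary f -> L2 Omega f.
  move=> ef; apply: (continuous_L2 _ _ _ mO fO cK OK).
  exact/smooth_continuous/elementary_smooth.
have FB := Fu B _ (H10_bubble hz hlambda fO).
have iDu i := L2M_integrable mO (l2Du i) (L2e _ (eB' i)).
have iu i := L2M_integrable mO l2u (L2e _ (elementary_partial i _ (eB' i))).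
have key : F B = k * integral_on Omega u.
  rewrite -FB; transitivity (integral_on Omega (fun p => Du ord0 p * partial ord0 B p) +
    integral_on Omega (fun p => Du (lift ord0 ord0) p * partial (lift ord0 ord0) B p)).
    rewrite /integral_on -(RintegralD mO (iDu _) (iDu _)).
    by apply: eq_Rintegral => p _; rewrite sum_ord2.
  (* Here [g] is [partial i B], so the derivative on [u] moves to a second derivative of [B]. *)
  rewrite !(H10_by_parts _ _ _ _ _ _ mO fO cK OK hu (elementary_smooth _ (eB' _))).
  rewrite -opprD /integral_on -(RintegralD mO (iu _) (iu _)).
  have lap p : u p * partial ord0 (partial ord0 B) p +
      u p * partial (lift ord0 ord0) (partial (lift ord0 ord0) B) p = - k * u p.
    by rewrite -mulrDr -(laplacian_bubble hz hlambda _ _ _ _ E gram p) sum_ord2 mulrC.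
  under eq_Rintegral do rewrite lap.
  by rewrite (RintegralZl _ mO (L2_integrable mO fO l2u)) mulNr opprK.
(* The area being [1 / (sqrt 3 * k)], the factor [sqrt 3 * area * k] equals 1. *)
rewrite key aO /=; field.
by rewrite !gt_eqF// sqrtr_gt0.
Qed.
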